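(* Let $\pi:M\to\mathbb R^2$ be the blowing-up of $\mathbb R^2$ with center the origin, let $f:\mathbb R^2\to\mathbb R$ be $f(x,y)=y$, and for $\epsilon\in\mathbb R$ let $c_\epsilon\in\mathcal A_0(\mathbb R^2)$ be the arc $c_\epsilon(t)=(\epsilon t,t^2)$ (so that $c_\epsilon\to c_0$ in the product topology as $\epsilon\to0$). There exists an analytic diffeomorphism $\Phi:M\to M$ such that: (i) $\Phi$ induces a blow-analytic homeomorphism $\phi:\mathbb R^2\to\mathbb R^2$ with $\phi(0)=0$, i.e. $\phi\circ\pi=\pi\circ\Phi$; (ii) $f\circ\phi=f$; (iii) $\phi_*(c_\epsilon)$ does not converge to $\phi_*(c_0)$ in the product topology as $\epsilon\to0$. In particular, there is a blow-analytic homeomorphism germ $\phi$ realising the blow-analytic equivalence of two non-zero analytic function germs such that the induced mapping $\phi_*:\mathcal A_0(\mathbb R^2)\to\mathcal A_0(\mathbb R^2)$, $c\mapsto\phi\circ c$, is not continuous with respect to the product topology.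
   Context: $\mathbb R\{t\}$ is the ring of convergent power series in one variable over $\mathbb R$, and $\mathcal A_0(\mathbb R^n)=\{c\in\mathbb R\{t\}^n:c(0)=0\}$ is regarded as the set of germs at $0$ of analytic curves $c:[0,\epsilon)\to\mathbb R^n$ with $c(0)=0$. The product topology on $\mathbb R\{t\}$ (and on $\mathbb R\{t\}^n$) is the topology of coefficientwise convergence, i.e. induced from the product $\mathbb R^{\mathbb N}$ of copies of $\mathbb R$ with its usual topology. A homeomorphism $\phi:U\to V$ between open subsets of $\mathbb R^n$ is a blow-analytic homeomorphism if there exist two finite sequences of blowings-up along smooth analytic centres $\pi:M\to U$ and $\sigma:N\to V$ and an analytic diffeomorphism $\Phi:M\to N$ such that $\phi\circ\pi=\sigma\circ\Phi$. Such a $\phi$ sends analytic arcs to analytic arcs by composition, so when $\phi(0)=0$ it induces a map $\phi_*:\mathcal A_0(\mathbb R^n)\to\mathcal A_0(\mathbb R^n)$, $\phi_*(c)=\phi\circ c$. Analytic function germs $f,g:(\mathbb R^n,0)\to(\mathbb R,0)$ are blow-analytically equivalent if $f=g\circ\phi$ as germs at $0$ for some blow-analytic homeomorphism $\phi:U\to V$ between open sets containing $0$ with $\phi(0)=0$; one then says that $\phi$ realises the equivalence and its germ at $0$ is called a blow-analytic homeomorphism germ. *)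

(* Defs.v *)
From HB Require Import structures.
From mathcomp Require Import all_boot all_order all_algebra.
From mathcomp Require Import all_classical all_reals all_analysis.
Import Order.TTheory GRing.Theory Num.Theory.
Import numFieldNormedType.Exports.

Set Implicit Arguments.
Unset Strict Implicit.
Unset Printing Implicit Defensive.

Local Open Scope classical_set_scope.
Local Open Scope ring_scope.

(* The real line is an arbitrary [R : realType] and R^n is ['rV[R]_n]. *)

Section RealAnalytic.
Context {R : realType}.

(* Partial sum, over the multi-indices with all entries < N, of the power
   series with coefficients [a] at [x]. *)
Definition mpseries n (a : {ffun 'I_n -> nat} -> R) (x : 'rV[R]_n) : R^nat :=
  fun N => \sum_(k : {ffun 'I_n -> 'I_N})
    a [ffun i => k i : nat] * \prod_(i < n) x 0 i ^+ k i.

(* The expansion is required to converge absolutely near [p], so that summing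
   over cubes of multi-indices is immaterial. *)
Definition analytic_at n (f : 'rV[R]_n -> R) (p : 'rV[R]_n) :=
  exists a : {ffun 'I_n -> nat} -> R, \forall x \near p,
    cvgn (mpseries (fun k => `|a k|) (map_mx Num.norm (x - p))) /\
    mpseries a (x - p) @ \oo --> f x.

Definition analytic_vec_at m n (f : 'rV[R]_m -> 'rV[R]_n) (p : 'rV[R]_m) :=
  forall i, analytic_at (fun x => f x 0 i) p.

End RealAnalytic.

Record chart (R : realType) (n : nat) (T : Type) :=
  Chart { chart_dom : set T; chart_map :> T -> 'rV[R]_n }.

(* A topological space with a family of R^n-valued charts; the manifold axioms
   are the predicate [is_analytic_manifold]. *)
Record charted_space (R : realType) (n : nat) := ChartedSpace {
  charted_carrier :> topologicalType;
  atlas : set (chart R n charted_carrier) }.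

Section Manifolds.
Context {R : realType}.

Definition analytic_map_at m n (M : charted_space R m) (N : charted_space R n)
    (F : M -> N) (p : M) :=
  F @ p --> F p /\
  forall (c : chart R m M) (d : chart R n N),
    atlas c -> atlas d -> chart_dom c p -> chart_dom d (F p) ->
    exists2 g : 'rV[R]_m -> 'rV[R]_n,
      analytic_vec_at g (c p) & \forall q \near p, d (F q) = g (c q).

Definition is_analytic_manifold n (M : charted_space R n) :=
  [/\ hausdorff_space M,
      @second_countable M,
      forall p : M, exists2 c : chart R n M, atlas c & chart_dom c p,
      forall c : chart R n M, atlas c ->
        [/\ open (chart_dom c),
            {in chart_dom c &, injective c},
            {in chart_dom c, continuous c} &
            forall A : set M, open A -> A `<=` chart_dom c -> open (c @` A)] &
      (* compatibility of the charts *)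
      forall p : M, analytic_map_at (idfun : M -> M) p].

(* [F] restricts to an analytic diffeomorphism from the open set [A] onto the
   open set [B]. *)
Definition analytic_diffeo_on m n (M : charted_space R m)
    (N : charted_space R n) (A : set M) (B : set N) (F : M -> N) :=
  [/\ open A, open B, set_bij A B F,
      forall p, A p -> analytic_map_at F p &
      exists2 G : N -> M, {in A, cancel F G} &
        forall q, B q -> analytic_map_at G q].

Definition analytic_diffeo m n (M : charted_space R m)
    (N : charted_space R n) (F : M -> N) :=
  analytic_diffeo_on [set: M] [set: N] F.

Definition euclidean n : charted_space R n :=
  @ChartedSpace R n 'rV[R]_n [set Chart [set: 'rV[R]_n] id].

Definition open_subspace n (U : set 'rV[R]_n) : charted_space R n :=
  @ChartedSpace R n (set_type U)
    [set Chart [set: set_type U] (fun x => set_val x)].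

(* For a set [S] of coordinates, the blowing-up of R^n along the coordinate
   subspace {x | x_i = 0 for i in S} is the incidence variety of the pairs
   (x, l), with l a line of R^S (a point of the projective space of R^S)
   containing x_S = (x_i)_{i in S}. The line l is represented by the matrix P of
   the orthogonal projection onto it, which gives the projective space its usual
   topology; x_S lies on l iff x_S P = x_S. *)
Definition coord_part n (S : {pred 'I_n}) (x : 'rV[R]_n) : 'rV[R]_n :=
  \row_j (if j \in S then x 0 j else 0).

Definition blowup_set n (S : {pred 'I_n}) : set ('rV[R]_n * 'M[R]_n) :=
  [set xP | [/\ xP.2^T = xP.2, xP.2 *m xP.2 = xP.2, \tr xP.2 = 1,
      forall i j, i \notin S -> xP.2 i j = 0 &
      coord_part S xP.1 *m xP.2 = coord_part S xP.1]].

Definition blowup_point n (S : {pred 'I_n}) (z : set_type (blowup_set S)) :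
  'rV[R]_n := (set_val z).1.

Definition blowup_line n (S : {pred 'I_n}) (z : set_type (blowup_set S)) :
  'M[R]_n := (set_val z).2.

(* The usual affine chart: if l is spanned by u and u_i <> 0, the coordinates of
   (x, l) are x_i, the ratios u_j / u_i (j in S, j <> i) and the x_j (j not in
   S). Row i of P is u_i u / |u|^2, and it is nonzero iff P i i <> 0. *)
Definition blowup_chart n (S : {pred 'I_n}) (i : 'I_n) :
    chart R n (set_type (blowup_set S)) :=
  Chart [set z | blowup_line z i i != 0]
    (fun z => \row_j (if (j \in S) && (j != i)
                      then blowup_line z i j / blowup_line z i i
                      else blowup_point z 0 j)).

Definition std_blowup n (S : {pred 'I_n}) : charted_space R n :=
  @ChartedSpace R n (set_type (blowup_set S))
    [set blowup_chart S i | i in [set i | i \in S]].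

Definition std_blowdown n (S : {pred 'I_n}) : std_blowup S -> euclidean n :=
  fun z => blowup_point z.

(* [b] is the blowing-up of [M] along the closed analytic submanifold [C]: an
   analytic diffeomorphism off [C] and, near each point of [C], isomorphic to a
   standard blowing-up in coordinates [k] that map [C] to a coordinate subspace
   (of positive codimension, possibly depending on the component of [C]). *)
Definition is_blowing_up n (M M' : charted_space R n) (C : set M)
    (b : M' -> M) :=
  [/\ closed C,
      analytic_diffeo_on (b @^-1` (~` C)) (~` C) b &
      forall p, C p ->
        exists (W : set M) (O : set (euclidean n)) (k : M -> euclidean n)
               (S : {pred 'I_n}) (Psi : M' -> std_blowup S),
        [/\ W p, (exists i, i \in S), analytic_diffeo_on W O k,
            (forall q, W q -> C q <-> coord_part S (k q) = 0) &
            analytic_diffeo_on (b @^-1` W) (@std_blowdown n S @^-1` O) Psi /\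
            (forall z, W (b z) -> std_blowdown (Psi z) = k (b z))]].

Inductive blowing_up_seq n (U : charted_space R n) :
    forall M : charted_space R n, (M -> U) -> Prop :=
| blowing_up_nil : @blowing_up_seq n U U id
| blowing_up_cons (M M' : charted_space R n) (C : set M)
    (pi : M -> U) (b : M' -> M) :
    blowing_up_seq pi -> is_analytic_manifold M' -> is_blowing_up C b ->
    @blowing_up_seq n U M' (pi \o b).

Definition homeo_on n (U V : set 'rV[R]_n) (phi : 'rV[R]_n -> 'rV[R]_n) :=
  [/\ set_bij U V phi, {within U, continuous phi} &
      exists2 psi : 'rV[R]_n -> 'rV[R]_n,
        {in U, cancel phi psi} & {within V, continuous psi}].

(* The values of [phi] off [U] are irrelevant. *)
Definition blow_analytic_homeo n (U V : set 'rV[R]_n)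
    (phi : 'rV[R]_n -> 'rV[R]_n) :=
  [/\ open U, open V, homeo_on U V phi &
      exists (M N : charted_space R n) (pi : M -> open_subspace U)
             (sigma : N -> open_subspace V) (Phi : M -> N),
      [/\ blowing_up_seq pi, blowing_up_seq sigma, analytic_diffeo Phi &
          forall z, phi (set_val (pi z)) = set_val (sigma (Phi z))]].

Definition analytic_fun_germ n (f : 'rV[R]_n -> R) :=
  analytic_at f 0 /\ f 0 = 0.

Definition nonzero_germ n (f : 'rV[R]_n -> R) :=
  ~ (\forall x \near (0 : 'rV[R]_n), f x = 0).

Definition realises_blow_analytic_equivalence n (U V : set 'rV[R]_n)
    (phi : 'rV[R]_n -> 'rV[R]_n) (f g : 'rV[R]_n -> R) :=
  [/\ U 0, V 0, blow_analytic_homeo U V phi, phi 0 = 0 &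
      \forall x \near (0 : 'rV[R]_n), f x = g (phi x)].

End Manifolds.

Section Arcs.
Context {R : realType}.

Definition convergent_series (a : R^nat) :=
  exists2 r : R, 0 < r & cvgn (pseries a r).

(* A_0(R^n): the arc sum_k c_k t^k is the sequence of its coefficients
   c_k in R^n. The type [set_type (arc_germs n)] carries the topology induced by
   the product topology on (R^n)^nat. *)
Definition arc_germs n : set (prod_topology (fun _ : nat => 'rV[R]_n)) :=
  [set c | c 0%N = (0 : 'rV[R]_n) /\ forall i, convergent_series (fun k => c k 0 i)].

Definition arc_eval n (c : set_type (@arc_germs n)) (t : R) : 'rV[R]_n :=
  \row_i limn (pseries (fun k => set_val c k 0 i) t).

(* [phi_star c] is the germ of [phi \o c]. *)
Definition induces_on_arcs n (phi : 'rV[R]_n -> 'rV[R]_n)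
    (phi_star : set_type (@arc_germs n) -> set_type (@arc_germs n)) :=
  forall c, \forall t \near (0 : R)^'+,
    phi (arc_eval c t) = arc_eval (phi_star c) t.

Definition point2 (x y : R) : 'rV[R]_2 := \row_(j < 2) [:: x; y]`_j.

Definition parabola_coef (e : R) (k : nat) : 'rV[R]_2 :=
  if k == 1%N then point2 e 0 else if k == 2%N then point2 0 1 else 0.

Lemma parabola_subproof (e : R) : parabola_coef e \in @arc_germs 2.
Proof.
apply/mem_set; split=> [//|i].
exists 1 => //.
apply: (@is_cvg_near_cst _ _ (pseries (fun k => parabola_coef e k 0 i) 1 3%N)).
near=> N; have N3 : (3 <= N)%N by near: N; exists 3%N.
have tail0 : \sum_(3 <= k < N) parabola_coef e k 0 i * 1 ^+ k = 0.
  rewrite big_nat_cond big1 // => -[|[|[|k]]] // _.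
  by rewrite /parabola_coef /= mxE mul0r.
by rewrite /pseries /series /= (big_cat_nat (n := 3%N)) //= tail0 addr0.
Unshelve. all: by end_near.
Qed.

(* The arc t |-> (e t, t^2). *)
Definition parabola_arc (e : R) : set_type (@arc_germs 2) :=
  exist _ (parabola_coef e) (parabola_subproof e).

End Arcs.

(* Main.v *)
(** Put [phi (x, y) := (X, y)], where [X] has the sign of [x] and
    [X - y^2 / X = x - y^2 / x + 2 y], and [X = 0] if [x = 0]. Replacing [2 y]
    by [- 2 y] gives the inverse. The map [phi] is homogeneous of degree one,
    so it acts on lines through the origin and lifts to the blowing-up. Along
    [y = s x] we have [X = x K(s)], where [K] is the positive root of
    [K^2 = (1 + 2 s - s^2) K + s^2], and along [x = w y] we have
    [X = x / K'(w)], where [K'] is the similar root for the inverse. Both roots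
    are simple, hence analytic, so the lift is an analytic diffeomorphism.

    For [e > 0] the arc [(e t, t^2)] is sent to [(e t K(t / e), t^2)], whose
    first coordinate is [e t + 2 t^2 + O(t^4)], whereas [(0, t^2)] is fixed: the
    coefficient of [t^2] jumps from [2] to [0] as [e] tends to [0].

    A simple root of a quadratic equation with analytic coefficients is
    expanded by solving [c v = d + z (a v + e v^2)] recursively; the bound on
    [sum |v_k| s^k] is propagated from one partial sum to the next for small
    [s]. *)
Require Import Defs.
From HB Require Import structures.
From mathcomp Require Import all_boot all_order all_algebra.
From mathcomp Require Import all_classical all_reals all_analysis.
From mathcomp Require Import ring lra.
Import Order.TTheory GRing.Theory Num.Theory.
Import numFieldNormedType.Exports.

Set Implicit Arguments.
Unset Strict Implicit.
Unset Printing Implicit Defensive.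

Local Open Scope classical_set_scope.
Local Open Scope ring_scope.

(** * Absolutely convergent power series *)

Section PowerSeries.
Context {R : realType}.
Implicit Types (a b : R^nat) (r z M N : R).

Definition psum a z : R := limn (pseries a z).

(** Absolute convergence at radius [r] with an explicit constant. Stating it on partial sums allows
    proofs by induction on their length, without passing to a limit. *)
Definition abs_bound a r M :=
  forall n, \sum_(0 <= k < n) `|a k| * r ^+ k <= M.

Lemma abs_bound_ge0 a r M : abs_bound a r M -> 0 <= M.
Proof. by move/(_ 0%N); rewrite big_geq. Qed.

Lemma abs_bound_le a r s M :
  0 <= s -> s <= r -> abs_bound a r M -> abs_bound a s M.
Proof.
move=> s0 sr aM n; apply: le_trans (aM n).
by apply: ler_sum => k _; rewrite ler_wpM2l// lerXn2r// nnegrE (le_trans s0).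
Qed.

Lemma abs_bound_cvg a r M : 0 <= r -> abs_bound a r M ->
  cvgn (pseries (fun k => `|a k|) r).
Proof.
move=> r0 aM; apply: nondecreasing_is_cvgn.
  by apply: nondecreasing_series => k _ _; rewrite mulr_ge0// exprn_ge0.
by exists M => _ [n _ <-]; exact: aM.
Qed.

Lemma abs_bound_is_cvg a r M z : abs_bound a r M -> `|z| <= r ->
  cvgn (pseries a z).
Proof.
move=> aM zr; apply: normed_cvg.
rewrite (_ : [normed _] = pseries (fun k => `|a k|) `|z|); last first.
  by apply/funext => n /=; apply: eq_bigr => k _; rewrite normrM normrX.
by apply: (@abs_bound_cvg _ _ M) => //; exact: abs_bound_le aM.
Qed.

Lemma psum_cvg a r M z : abs_bound a r M -> `|z| <= r ->
  pseries a z @ \oo --> psum a z.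
Proof. exact: abs_bound_is_cvg. Qed.

Lemma psumP a z l : pseries a z @ \oo --> l -> psum a z = l.
Proof. by move=> h; apply: cvg_lim. Qed.

Lemma psum_bound a r M z : abs_bound a r M -> `|z| <= r -> `|psum a z| <= M.
Proof.
move=> aM zr; have /cvg_norm h := psum_cvg aM zr.
rewrite -(cvg_lim _ h)//; apply: limr_le; first by apply/cvg_ex; exists `|psum a z|.
apply: nearW => n; apply: le_trans (abs_bound_le (normr_ge0 z) zr aM n).
by apply: le_trans (ler_norm_sum _ _ _) _; apply: ler_sum => k _; rewrite normrM normrX.
Qed.

Lemma abs_bound_shift a r M : 0 < r -> abs_bound a r M ->
  abs_bound (fun k => a k.+1) r (M / r).
Proof.
move=> r0 aM n; rewrite ler_pdivlMr//; apply: le_trans (aM n.+1).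
rewrite big_nat_recl//= mulr_suml -[leLHS]add0r lerD ?mulr_ge0//.
by apply: ler_sum => k _; rewrite exprSr mulrA.
Qed.

Lemma psum_recl a r M z : 0 < r -> abs_bound a r M -> `|z| <= r ->
  psum a z = a 0%N + z * psum (fun k => a k.+1) z.
Proof.
move=> r0 aM zr; apply: psumP; rewrite -cvg_shiftS /=.
rewrite (_ : (fun n => _) = (fun n => a 0%N + z * pseries (fun k => a k.+1) z n)).
  apply: cvgD; first exact: cvg_cst.
  by apply: cvgMr; exact: psum_cvg (abs_bound_shift r0 aM) zr.
apply/funext => n; rewrite /pseries /series /= big_nat_recl//= expr0 mulr1.
by congr (_ + _); rewrite mulr_sumr; apply: eq_bigr => k _; rewrite exprS mulrCA.
Qed.

Lemma abs_boundD a b r M N : 0 <= r -> abs_bound a r M -> abs_bound b r N ->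
  abs_bound (fun k => a k + b k) r (M + N).
Proof.
move=> r0 aM bN n; apply: le_trans (lerD (aM n) (bN n)); rewrite -big_split /=.
by apply: ler_sum => k _; rewrite -mulrDl ler_wpM2r ?exprn_ge0// ler_normD.
Qed.

Lemma psumD a b r M N z : abs_bound a r M -> abs_bound b r N -> `|z| <= r ->
  psum (fun k => a k + b k) z = psum a z + psum b z.
Proof.
move=> aM bN zr; apply: psumP.
rewrite (_ : pseries _ z = (fun n => pseries a z n + pseries b z n)).
  by apply: cvgD; [exact: psum_cvg aM zr|exact: psum_cvg bN zr].
apply/funext => n; rewrite /pseries /series /= -big_split.
by apply: eq_bigr => k _; rewrite mulrDl.
Qed.

Lemma abs_boundZ (c : R) a r M : abs_bound a r M ->
  abs_bound (fun k => c * a k) r (`|c| * M).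
Proof.
move=> aM n; apply: le_trans (ler_wpM2l (normr_ge0 c) (aM n)).
by rewrite mulr_sumr; apply: ler_sum => k _; rewrite normrM mulrA.
Qed.

Lemma psumZ (c : R) a r M z : abs_bound a r M -> `|z| <= r ->
  psum (fun k => c * a k) z = c * psum a z.
Proof.
move=> aM zr; apply: psumP.
rewrite (_ : pseries _ z = (fun n => c * pseries a z n)).
  by apply: cvgMr; exact: psum_cvg aM zr.
apply/funext => n; rewrite /pseries /series /= mulr_sumr.
by apply: eq_bigr => k _; rewrite mulrA.
Qed.

(** * Cauchy products *)

Definition cauchy_prod a b : R^nat := fun n => \sum_(i < n.+1) a i * b (n - i)%N.

Let trunc a n : {poly R} := \poly_(i < n) a i.

Let truncE a n z : (trunc a n).[z] = pseries a z n.
Proof. by rewrite horner_poly /pseries /series /= big_mkord. Qed.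

Let coef_trunc_prod a b n k : (k < n)%N ->
  (trunc a n * trunc b n)`_k = cauchy_prod a b k.
Proof.
move=> kn; rewrite coefM; apply: eq_bigr => -[i /= ik] _.
by rewrite !coef_poly (leq_ltn_trans _ kn)// (leq_ltn_trans (leq_subr _ _) kn).
Qed.

(** The product of the two truncations is a polynomial of degree below [2 n]. Below degree [n] its
    coefficients are those of the Cauchy product; the other ones form the defect. *)
Let trunc_prodE a b n z : pseries a z n * pseries b z n =
  pseries (cauchy_prod a b) z n +
  \sum_(n <= k < n.*2) (trunc a n * trunc b n)`_k * z ^+ k.
Proof.
have sz : (size (trunc a n * trunc b n)%R <= n.*2)%N.
  apply: leq_trans (size_polyMleq _ _) _; apply: leq_trans (leq_pred _) _.
  by rewrite -addnn leq_add// size_poly.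
rewrite -!truncE -hornerM (horner_coef_wide _ sz) -(big_mkord xpredT
  (fun i => (trunc a n * trunc b n)`_i * z ^+ i)).
rewrite (big_cat_nat (n := n)) ?leq0n -?addnn ?leq_addr//=; congr (_ + _).
rewrite truncE /pseries /series /= !big_nat.
by apply: eq_bigr => k kn; rewrite coef_trunc_prod.
Qed.

Let norm_trunc_prod a b n k : `|(trunc a n * trunc b n)`_k| <=
  (trunc (fun k => `|a k|) n * trunc (fun k => `|b k|) n)`_k.
Proof.
rewrite !coefM; apply: le_trans (ler_norm_sum _ _ _) _; apply: ler_sum => i _.
by rewrite normrM !coef_poly; do 2 case: ifP => _; rewrite ?normr0.
Qed.

Lemma cauchy_prod_norm a b k : `|cauchy_prod a b k| <=
  cauchy_prod (fun k => `|a k|) (fun k => `|b k|) k.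
Proof. by apply: le_trans (ler_norm_sum _ _ _) _; apply: ler_sum => i _; rewrite normrM. Qed.

Lemma cauchy_prod_partial a b r n : 0 <= r ->
  \sum_(0 <= k < n) `|cauchy_prod a b k| * r ^+ k <=
  (\sum_(0 <= k < n) `|a k| * r ^+ k) * (\sum_(0 <= k < n) `|b k| * r ^+ k).
Proof.
move=> r0; have := trunc_prodE (fun k => `|a k|) (fun k => `|b k|) n r.
rewrite {1 2}/pseries /series /= => ->; rewrite -[leLHS]addr0 lerD//.
  by apply: ler_sum => k _; rewrite ler_wpM2r ?exprn_ge0// cauchy_prod_norm.
apply: sumr_ge0 => k _; rewrite mulr_ge0 ?exprn_ge0//.
by apply: le_trans (norm_trunc_prod a b n k); rewrite normr_ge0.
Qed.

Lemma abs_boundM a b r M N : 0 <= r -> abs_bound a r M -> abs_bound b r N ->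
  abs_bound (cauchy_prod a b) r (M * N).
Proof.
move=> r0 aM bN n; apply: le_trans (cauchy_prod_partial _ _ _ r0) _.
by apply: ler_pM => //; apply: sumr_ge0 => k _; rewrite mulr_ge0 ?exprn_ge0.
Qed.

Lemma psumM a b r M N z : abs_bound a r M -> abs_bound b r N -> `|z| <= r ->
  psum (cauchy_prod a b) z = psum a z * psum b z.
Proof.
move=> aM bN zr; have r0 : 0 <= r by apply: le_trans zr.
pose a' : R^nat := fun k => `|a k|; pose b' : R^nat := fun k => `|b k|.
have ab'M : abs_bound (cauchy_prod a' b') r (M * N).
  by apply: abs_boundM => // n; under eq_bigr do rewrite normr_id; [exact: aM|exact: bN].
have nn k : cauchy_prod a' b' k = `|cauchy_prod a' b' k|.
  by rewrite ger0_norm// sumr_ge0// => i _; rewrite mulr_ge0 /a' /b'.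
have cA := abs_bound_cvg r0 aM; have cB := abs_bound_cvg r0 bN.
have cC : cvgn (pseries (cauchy_prod a' b') r).
  by rewrite (_ : cauchy_prod a' b' = fun k => `|cauchy_prod a' b' k|);
     [exact: abs_bound_cvg ab'M|exact/funext].
pose D n := pseries a' r n * pseries b' r n - pseries (cauchy_prod a' b') r n.
have DE n : D n = \sum_(n <= k < n.*2) (trunc a' n * trunc b' n)`_k * r ^+ k.
  by rewrite /D trunc_prodE addrC addKr.
have trunc_ge0 n k : 0 <= (trunc a' n * trunc b' n)`_k.
  by apply: le_trans (norm_trunc_prod a b n k); rewrite normr_ge0.
(* The absolute product of partial sums lies between the partial sums of order
   [n] and [2 n] of the Cauchy product, so that the defect [D] tends to 0. *)
have D0 : D @ \oo --> 0.
  apply: (@squeeze_cvgr _ _ _ _ (fun=> 0) (fun n =>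
    pseries (cauchy_prod a' b') r n.*2 - pseries (cauchy_prod a' b') r n)).
  - apply: nearW => n; rewrite {1}DE sumr_ge0 => [|k _]; last first.
      by rewrite mulr_ge0// exprn_ge0.
    rewrite /= /D lerD2r trunc_prodE /pseries /series /=.
    rewrite [leRHS](big_cat_nat (n := n)) ?leq0n -?addnn ?leq_addr//= lerD2l.
    apply: ler_sum => k _; rewrite ler_wpM2r ?exprn_ge0// coefM.
    apply: ler_sum => i _; rewrite !coef_poly.
    by do 2 case: ifP => _; rewrite ?mul0r ?mulr0// mulr_ge0 /a' /b'.
  - exact: cvg_cst.
  - rewrite -(subrr (limn (pseries (cauchy_prod a' b') r))); apply: cvgB => //.
    have h : (fun n => n.*2) @ \oo --> \oo.
      move=> A [m _ mA]; exists m => // n /= mn; apply: mA => /=.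
      by rewrite -addnn (leq_trans mn)// leq_addr.
    exact: (cvg_comp _ _ h cC).
(* The signed defect at [z] is dominated term by term by [D]. *)
have E0 : (fun n => \sum_(n <= k < n.*2) (trunc a n * trunc b n)`_k * z ^+ k)
    @ \oo --> (0 : R).
  apply: norm_cvg0; apply: (@squeeze_cvgr _ _ _ _ (fun=> 0) D) => //; last exact: cvg_cst.
  apply: nearW => n /=; rewrite normr_ge0 DE.
  apply: le_trans (ler_norm_sum _ _ _) _; apply: ler_sum => k _.
  by rewrite normrM normrX ler_pM ?exprn_ge0// ?lerXn2r ?nnegrE ?norm_trunc_prod.
apply: psumP; rewrite -[_ * _]subr0.
rewrite (_ : pseries (cauchy_prod a b) z = (fun n => pseries a z n * pseries b z n -
  \sum_(n <= k < n.*2) (trunc a n * trunc b n)`_k * z ^+ k)); last first.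
  by apply/funext => n; rewrite trunc_prodE addrK.
by apply: cvgB => //; apply: cvgM; [exact: psum_cvg aM zr|exact: psum_cvg bN zr].
Qed.

(** * Power series solution of a quadratic equation *)

Lemma exists_small_mul (x M : R) : 0 < x -> 0 <= M ->
  exists2 s : R, 0 < s & s * M < x.
Proof.
move=> x0 M0; exists (x / (M + 1)); first by rewrite divr_gt0// ltr_wpDl.
rewrite -mulrAC ltr_pdivrMr ?ltr_wpDl// mulrDr mulr1.
by rewrite ltrDl.
Qed.

(* The coefficients of the solution of [c v = d + z (a v + e v^2)]; the function
   [implicit_table n] is correct up to the index [n]. *)
Fixpoint implicit_table (c e : R) (d a : R^nat) n : R^nat :=
  if n is n'.+1 then fun k =>
    let v := implicit_table c e d a n' in
    if (k <= n')%N then v k else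
      (d n'.+1 + (cauchy_prod a v n' + e * cauchy_prod v v n')) / c
  else fun=> d 0%N / c.

Definition implicit_coef c e d a n := implicit_table c e d a n n.

Let implicit_tableE c e d a n k : (k <= n)%N ->
  implicit_table c e d a n k = implicit_coef c e d a k.
Proof.
elim: n => [|n IH]; first by rewrite leqn0 => /eqP ->.
rewrite leq_eqVlt => /orP[/eqP -> //|kn]; rewrite /= -ltnS kn.
exact: IH.
Qed.

Lemma eq_cauchy_prod a a' b b' n :
  (forall k, (k <= n)%N -> a k = a' k) -> (forall k, (k <= n)%N -> b k = b' k) ->
  cauchy_prod a b n = cauchy_prod a' b' n.
Proof.
by move=> aa bb; apply: eq_bigr => -[i /= ?] _; rewrite aa// bb// leq_subr.
Qed.

Lemma implicit_coefS c e d a n (v := implicit_coef c e d a) : v n.+1 =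
  (d n.+1 + (cauchy_prod a v n + e * cauchy_prod v v n)) / c.
Proof.
rewrite {1}/v /implicit_coef /= ltnn; congr ((_ + (_ + _ * _)) / _);
  by apply: eq_cauchy_prod => // k kn; exact: implicit_tableE.
Qed.

(** Comparison of coefficients determines [v] recursively. Since the products involving [v] carry a
    factor [z], shrinking the radius makes their contribution small, so that one constant bounds all
    partial sums. *)
Lemma implicit_solution c e d a r M N : c != 0 -> 0 < r ->
  abs_bound d r M -> abs_bound a r N ->
  exists v s L, [/\ 0 < s, s <= r, abs_bound v s L, v 0%N = d 0%N / c &
    forall z, `|z| <= s ->
      c * psum v z = psum d z + z * (psum a z * psum v z + e * psum v z ^+ 2)].
Proof.
move=> c0 r0 dM aN; pose v := implicit_coef c e d a.
have vS k : v k.+1 = (d k.+1 + (cauchy_prod a v k + e * cauchy_prod v v k)) / c.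
  exact: implicit_coefS.
have M0 := abs_bound_ge0 dM; have N0 := abs_bound_ge0 aN.
have nc : 0 < `|c| by rewrite normr_gt0.
(* After multiplication by the absolute value of [c], the terms of [d] contribute at most [M] and
   the product terms, by the choice of [s], at most [1]; [L] accommodates [M + 1]. *)
pose L := (M + 1) * 2 / `|c|.
have L0 : 0 <= L by rewrite divr_ge0// mulr_ge0// addr_ge0.
have [s1 s10 s1M] : exists2 s1 : R, 0 < s1 & s1 * (N * L + `|e| * L ^+ 2) < 1.
  by apply: exists_small_mul => //; rewrite addr_ge0// mulr_ge0// exprn_ge0.
pose s := Num.min s1 r.
have s0 : 0 < s by rewrite lt_min s10.
have sr : s <= r by rewrite ge_min lexx orbT.
have sM : s * (N * L + `|e| * L ^+ 2) <= 1.
  apply: le_trans (ltW s1M); rewrite ler_wpM2r//; last by rewrite ge_min lexx.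
  by rewrite addr_ge0// mulr_ge0// exprn_ge0.
have ds := abs_bound_le (ltW s0) sr dM; have As := abs_bound_le (ltW s0) sr aN.
have vL : abs_bound v s L.
  elim=> [|n IH]; first by rewrite big_geq.
  have -> : L = (M + 1 + (M + 1)) / `|c| by rewrite /L; congr (_ / _); ring.
  rewrite ler_pdivlMr// mulr_suml big_nat_recl//=.
  rewrite expr0 mulr1 -normrM divfK//.
  apply: (@le_trans _ _ (\sum_(0 <= k < n.+1) `|d k| * s ^+ k +
     s * (\sum_(0 <= k < n) `|cauchy_prod a v k| * s ^+ k +
         `|e| * \sum_(0 <= k < n) `|cauchy_prod v v k| * s ^+ k))).
    rewrite [in leRHS]big_nat_recl//= expr0 mulr1 -addrA lerD2l.
    rewrite mulr_sumr -big_split mulr_sumr -big_split /=; apply: ler_sum => k _.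
    rewrite mulrAC -normrM vS divfK//.
    apply: (@le_trans _ _ ((`|d k.+1| + (`|cauchy_prod a v k| +
        `|e| * `|cauchy_prod v v k|)) * s ^+ k.+1)).
      rewrite ler_wpM2r ?exprn_ge0 ?(ltW s0)//.
      apply: le_trans (ler_normD _ _) _; rewrite lerD2l.
      by apply: le_trans (ler_normD _ _) _; rewrite lerD2l normrM.
    by rewrite le_eqVlt; apply/orP; left; apply/eqP; rewrite exprS; ring.
  have S0 : 0 <= \sum_(0 <= k < n) `|v k| * s ^+ k.
    by apply: sumr_ge0 => k _; rewrite mulr_ge0// exprn_ge0// ltW.
  rewrite -addrA lerD ?ds// addrA; apply: le_trans (_ : 1 <= _); last first.
    by lra.
  apply: le_trans sM; rewrite ler_wpM2l ?(ltW s0)// lerD//.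
    apply: le_trans (cauchy_prod_partial _ _ _ (ltW s0)) _.
    by apply: ler_pM => //; apply: sumr_ge0 => k _; rewrite mulr_ge0// exprn_ge0// ltW.
  rewrite ler_wpM2l//; apply: le_trans (cauchy_prod_partial _ _ _ (ltW s0)) _.
  by rewrite expr2; apply: ler_pM.
exists v, s, L; split => // z zs.
have vv := abs_boundM (ltW s0) vL vL; have av := abs_boundM (ltW s0) As vL.
have evv := abs_boundZ e vv; have sum2 := abs_boundD (ltW s0) av evv.
(* The constant terms agree because [c v_0 = d_0]. What remains is a multiple of [z] on both sides,
   and the cofactors agree coefficientwise by [vS]. *)
rewrite [in LHS](psum_recl s0 vL zs) (psum_recl s0 ds zs) mulrDr -addrA; congr (_ + _).
  by rewrite /v /implicit_coef /= mulrC divfK.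
rewrite mulrCA -mulrDr; congr (_ * _).
rewrite -(psumZ _ (abs_bound_shift s0 vL) zs) expr2 -(psumM vL vL zs).
rewrite -(psumM As vL zs) -(psumZ _ vv zs) -(psumD av evv zs).
rewrite -(psumD (abs_bound_shift s0 ds) sum2 zs); congr (psum _ z).
by apply/funext => k; rewrite vS mulrC divfK.
Qed.
End PowerSeries.

(** * Analytic functions of one variable *)

Section UnivariateGerms.
Context {R : realType}.
Implicit Types (u w : R -> R) (p : R).

Lemma psum_at0 (a : R^nat) (r M : R) : 0 < r -> abs_bound a r M -> psum a 0 = a 0%N.
Proof. by move=> r0 aM; rewrite (psum_recl r0 aM) ?normr0 ?(ltW r0)// mul0r addr0. Qed.

Definition scons (c : R) (a : R^nat) : R^nat := fun k => if k is k'.+1 then a k' else c.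

Lemma abs_bound_scons c a (r M : R) : 0 < r -> abs_bound a r M ->
  abs_bound (scons c a) r (`|c| + r * M).
Proof.
move=> r0 aM [|n].
  by rewrite big_geq// addr_ge0// mulr_ge0 ?(ltW r0)// (abs_bound_ge0 aM).
rewrite big_nat_recl//= expr0 mulr1 lerD2l; apply: le_trans (ler_wpM2l (ltW r0) (aM n)).
by rewrite mulr_sumr; apply: ler_sum => k _; rewrite exprS mulrCA.
Qed.

Lemma psum_scons c a (r M z : R) : 0 < r -> abs_bound a r M -> `|z| <= r ->
  psum (scons c a) z = c + z * psum a z.
Proof. by move=> r0 aM zr; rewrite (psum_recl r0 (abs_bound_scons c r0 aM) zr). Qed.

Lemma abs_bound0 (r : R) : abs_bound (fun=> 0 : R) r 0.
Proof. by move=> n; rewrite big1// => k _; rewrite normr0 mul0r. Qed.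

Lemma psum0 (z : R) : psum (fun=> 0 : R) z = 0.
Proof.
by apply/eqP; rewrite -normr_le0; apply: (psum_bound (abs_bound0 _)); exact: lexx.
Qed.

(** The expansion holds on a closed interval with an explicit radius and bound, which is the form in
    which the operations on series take their arguments. *)
Definition analytic1 u p := exists a r M,
  [/\ 0 < r, abs_bound a r M & forall z, `|z| <= r -> u (p + z) = psum a z].

Lemma analytic1_ext u w p : (\forall x \near p, u x = w x) ->
  analytic1 u p -> analytic1 w p.
Proof.
move=> /nbhs_ballP[e /= e0 uw] [a [r [M [r0 aM ua]]]].
exists a, (Num.min r (e / 2)), M; split.
- by rewrite lt_min r0 divr_gt0.
- apply: abs_bound_le aM; last by rewrite ge_min lexx.
  by rewrite le_min (ltW r0) divr_ge0// ltW.
- move=> z; rewrite le_min => /andP[zr ze]; rewrite -ua// uw//.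
  rewrite -ball_normE /= opprD addrA subrr add0r normrN.
  by rewrite (le_lt_trans ze)// ltr_pdivrMr// mulr_natr mulr2n ltrDl.
Qed.

Lemma analytic1_pair u w p : analytic1 u p -> analytic1 w p ->
  exists a b r M N, [/\ 0 < r, abs_bound a r M, abs_bound b r N,
    forall z, `|z| <= r -> u (p + z) = psum a z &
    forall z, `|z| <= r -> w (p + z) = psum b z].
Proof.
move=> [a [r [M [r0 aM ua]]]] [b [s [N [s0 bN wb]]]].
have m0 : 0 < Num.min r s by rewrite lt_min r0.
have mr : Num.min r s <= r by rewrite ge_min lexx.
have ms : Num.min r s <= s by rewrite ge_min lexx orbT.
exists a, b, (Num.min r s), M, N; split => //.
- exact: abs_bound_le (ltW m0) mr aM.
- exact: abs_bound_le (ltW m0) ms bN.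
- by move=> z /le_trans zm; rewrite ua// zm.
- by move=> z /le_trans zm; rewrite wb// zm.
Qed.

Lemma analytic1_cst c p : analytic1 (fun=> c) p.
Proof.
exists (scons c (fun=> 0)), 1, (`|c| + 1 * 0); split => //.
  exact: abs_bound_scons ltr01 (abs_bound0 _).
by move=> z z1; rewrite (psum_scons _ ltr01 (abs_bound0 _) z1) psum0 mulr0 addr0.
Qed.

Lemma analytic1_id p : analytic1 id p.
Proof.
have h : abs_bound (scons 1 (fun=> 0) : R^nat) 1 (`|1| + 1 * 0).
  exact: abs_bound_scons ltr01 (abs_bound0 _).
exists (scons p (scons 1 (fun=> 0))), 1, (`|p| + 1 * (`|1| + 1 * 0)); split => //.
  exact: abs_bound_scons ltr01 h.
move=> z z1; rewrite (psum_scons _ ltr01 h z1).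
by rewrite (psum_scons _ ltr01 (abs_bound0 _) z1) psum0 mulr0 addr0 mulr1.
Qed.

Lemma analytic1D u w p : analytic1 u p -> analytic1 w p ->
  analytic1 (fun x => u x + w x) p.
Proof.
move=> up wp; have [a [b [r [M [N [r0 aM bN ua wb]]]]]] := analytic1_pair up wp.
exists (fun k => a k + b k), r, (M + N); split => //; first exact: abs_boundD (ltW r0) aM bN.
by move=> z zr; rewrite ua// wb// (psumD aM bN zr).
Qed.

Lemma analytic1M u w p : analytic1 u p -> analytic1 w p ->
  analytic1 (fun x => u x * w x) p.
Proof.
move=> up wp; have [a [b [r [M [N [r0 aM bN ua wb]]]]]] := analytic1_pair up wp.
exists (cauchy_prod a b), r, (M * N); split => //; first exact: abs_boundM (ltW r0) aM bN.
by move=> z zr; rewrite ua// wb// (psumM aM bN zr).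
Qed.

Lemma analytic1N u p : analytic1 u p -> analytic1 (fun x => - u x) p.
Proof.
move=> up; rewrite (_ : (fun x => - u x) = (fun x => -1 * u x)); last first.
  by apply/funext => x; rewrite mulN1r.
by apply: analytic1M => //; exact: analytic1_cst.
Qed.

Lemma analytic1B u w p : analytic1 u p -> analytic1 w p ->
  analytic1 (fun x => u x - w x) p.
Proof. by move=> up wp; apply: analytic1D => //; exact: analytic1N. Qed.

(** The difference [u x - u p] is [x - p] times a bounded series. *)
Lemma analytic1_continuous u p : analytic1 u p -> u x @[x --> p] --> u p.
Proof.
move=> [a [r [M [r0 aM ua]]]].
have as_ := abs_bound_shift r0 aM; have M0 := abs_bound_ge0 as_.
apply/cvgrPdist_lt => e e0; have [s s0 sM] := exists_small_mul e0 M0.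
have m0 : 0 < Num.min r s by rewrite lt_min r0.
near=> x; have : `|x - p| < Num.min r s.
  by rewrite distrC; near: x; apply/nbhs_ballP; exists (Num.min r s).
rewrite lt_min => /andP[/ltW xr /ltW xs].
have -> : u x = psum a (x - p) by rewrite -ua// addrC subrK.
have -> : u p = psum a 0 by rewrite -ua ?addr0// normr0 ltW.
rewrite (psum_at0 r0 aM) (psum_recl r0 aM xr) opprD addrA subrr add0r normrN normrM.
apply: le_lt_trans sM; apply: ler_pM => //; exact: psum_bound as_ xr.
Unshelve. all: by end_near.
Qed.

(** Writing [u = a_0 + z A], the inverse [v] solves [a_0 v = 1 - z A v], which is the case [d = 1],
    [e = 0] of [implicit_solution]. *)
Lemma analytic1V u p : u p != 0 -> analytic1 u p -> analytic1 (fun x => (u x)^-1) p.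
Proof.
move=> up0 [a [r [M [r0 aM ua]]]].
have a0 : a 0%N != 0.
  by rewrite -(psum_at0 r0 aM) -ua ?addr0// normr0 ltW.
have as_ := abs_bound_shift r0 aM.
have oneM := abs_bound_scons 1 r0 (abs_bound0 r).
have [v [s [L [s0 sr vL _ vE]]]] := implicit_solution 0 a0 r0 oneM (abs_boundZ (-1) as_).
exists v, s, L; split => // z zs; have zr := le_trans zs sr.
move: (vE z zs); rewrite (psum_scons _ r0 (abs_bound0 _) zr) psum0 mulr0 addr0.
rewrite (psumZ _ as_ zr) mul0r addr0 ua// (psum_recl r0 aM zr).
set V := psum v z; set A := psum _ z => h.
have h1 : (a 0%N + z * A) * V = 1 by rewrite mulrDl h; ring.
exact: mulr1_eq h1.
Qed.

(* Writing a solution of the quadratic equation as [k0 + z v] turns it into an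
   equation for [v] of the form solved by [implicit_solution]. *)
Lemma analytic1_quadratic (b g : R -> R) p (k0 : R) :
  analytic1 b p -> analytic1 g p -> k0 ^+ 2 = b p * k0 + g p -> 2 * k0 != b p ->
  exists w, [/\ analytic1 w p, w p = k0 &
    \forall x \near p, w x ^+ 2 = b x * w x + g x].
Proof.
move=> bp gp k0E k0b.
have : analytic1 (fun x => b x * k0 + g x - k0 ^+ 2) p.
  apply: analytic1B; last exact: analytic1_cst.
  by apply: analytic1D => //; apply: analytic1M => //; exact: analytic1_cst.
move=> /(analytic1_pair bp)[a [d [r [M [N [r0 aM dN ba dE]]]]]].
have zr0 : `|0 : R| <= r by rewrite normr0 ltW.
have a0 : a 0%N = b p by rewrite -(psum_at0 r0 aM) -ba// addr0.
have d0 : d 0%N = 0 by rewrite -(psum_at0 r0 dN) -dE// addr0 k0E subrr.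
have as_ := abs_bound_shift r0 aM; have ds := abs_bound_shift r0 dN.
have c0 : 2 * k0 - b p != 0 by rewrite subr_eq0.
(* With [b = b p + z B] and [b k0 + g - k0^2 = z D], substituting [k0 + z v] and dividing by [z]
   gives [(2 k0 - b p) v = D + z (B v - v^2)]. The leading coefficient is nonzero because the root
   is simple. *)
have [v [s [L [s0 sr vL _ vE]]]] := implicit_solution (-1) c0 r0 ds as_.
have wL := abs_bound_scons k0 s0 vL.
exists (fun x => psum (scons k0 v) (x - p)); split.
- exists (scons k0 v), s, (`|k0| + s * L); split => // z zs.
  by congr (psum _ _); rewrite addrC addKr.
- by rewrite subrr (psum_at0 s0 wL).
- near=> x; have xs : `|x - p| <= s.
    rewrite distrC ltW//; near: x; apply/nbhs_ballP; exists s => //.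
  have xr := le_trans xs sr; rewrite (psum_scons _ s0 vL xs).
  have := vE _ xs; have := ba _ xr; have := dE _ xr; rewrite [p + _]addrC subrK.
  rewrite (psum_recl r0 aM xr) (psum_recl r0 dN xr) a0 d0 add0r.
  move: (x - p) => z; set V := psum v z; set D := psum _ z; set B := psum _ z.
  move=> dx bx; have -> : g x = z * D + k0 ^+ 2 - b x * k0 by rewrite -dx; ring.
  rewrite bx => h.
  have -> : (k0 + z * V) ^+ 2 = k0 ^+ 2 + z * ((2 * k0 - b p) * V) +
      z * b p * V + z ^+ 2 * V ^+ 2 by ring.
  by rewrite h; ring.
Unshelve. all: by end_near.
Qed.
End UnivariateGerms.

(** * The shear *)

Section Shear.
Context {R : realType}.
Implicit Types (b s k x y : R).

(** The parameter [b] is [1] for the map and [-1] for its inverse, so that each fact is proved once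
    for both. Substituting [X = x K] and [y = s x] in the equation of the shear gives
    [K^2 = kappa_lin b s K + s^2]. *)
Definition kappa_lin b s := 1 + 2 * b * s - s ^+ 2.

Definition kappa b s :=
  (kappa_lin b s + Num.sqrt (kappa_lin b s ^+ 2 + 4 * s ^+ 2)) / 2.

(** At [s = 0] the linear coefficient is [1], and elsewhere [4 s^2] is positive. The two roots are
    thus distinct for every [s], which makes [kappa] a simple root. *)
Let disc_gt0 b s : 0 < kappa_lin b s ^+ 2 + 4 * s ^+ 2.
Proof.
have [->|s0] := eqVneq s 0.
  by rewrite /kappa_lin mulr0 expr0n /= mulr0 subr0 !addr0 expr1n.
by rewrite ltr_wpDl ?sqr_ge0// mulr_gt0// lt0r sqrf_eq0 s0 sqr_ge0.
Qed.

Lemma kappa_disc b s : 2 * kappa b s - kappa_lin b s =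
  Num.sqrt (kappa_lin b s ^+ 2 + 4 * s ^+ 2).
Proof. by rewrite /kappa mulrC divfK// addrC addKr. Qed.

Lemma kappaE b s : kappa b s ^+ 2 = kappa_lin b s * kappa b s + s ^+ 2.
Proof.
have h := sqr_sqrtr (ltW (disc_gt0 b s)).
rewrite /kappa; move: h; set q := Num.sqrt _ => h.
have -> : ((kappa_lin b s + q) / 2) ^+ 2 =
   (kappa_lin b s ^+ 2 + 2 * kappa_lin b s * q + q ^+ 2) / 4 by field.
by rewrite h; field.
Qed.

Lemma kappa_gt0 b s : 0 < kappa b s.
Proof.
rewrite /kappa divr_gt0//; have [->|s0] := eqVneq s 0.
  rewrite /kappa_lin mulr0 expr0n /= mulr0 subr0 !addr0 expr1n sqrtr1.
  by rewrite addr_gt0.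
rewrite -ltrBlDl sub0r (le_lt_trans (ler_norm _))// normrN.
rewrite -sqrtr_sqr ltr_sqrt ?disc_gt0// ltrDl mulr_gt0//.
by rewrite lt0r sqrf_eq0 s0 sqr_ge0.
Qed.

(** A root different from [kappa b s] would be the other one, but the product of the two roots is
    [- s^2], which is not positive. The identities for [kappa] below are derived from this. *)
Lemma kappa_unique b s k : 0 < k -> k ^+ 2 = kappa_lin b s * k + s ^+ 2 ->
  k = kappa b s.
Proof.
move=> k0 kE; apply/eqP; rewrite -subr_eq0.
have h : (k - kappa b s) * (k + kappa b s - kappa_lin b s) = 0.
  have -> : (k - kappa b s) * (k + kappa b s - kappa_lin b s) =
    k ^+ 2 - kappa_lin b s * k - (kappa b s ^+ 2 - kappa_lin b s * kappa b s) by ring.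
  by rewrite kE kappaE; ring.
move/eqP: h; rewrite mulf_eq0 => /orP[//|/eqP h].
have kk : k * kappa b s = - s ^+ 2.
  have hk : kappa_lin b s = k + kappa b s by apply/eqP; rewrite eq_sym -subr_eq0 h.
  by move: kE; rewrite hk => e; lra.
have := mulr_gt0 k0 (kappa_gt0 b s); rewrite kk oppr_gt0 => s2.
by have := sqr_ge0 s; rewrite leNgt s2.
Qed.

Lemma kappa0 b : kappa b 0 = 1.
Proof.
apply/esym/kappa_unique => //.
by rewrite /kappa_lin mulr0 expr0n /= expr1n mulr1 !addr0 subr0.
Qed.

(** The quadratic equation has an analytic solution with the value of [kappa] at [p]. It remains
    positive near [p] by continuity, hence coincides with [kappa] there. *)
Lemma analytic1_kappa b (f : R -> R) p : analytic1 f p ->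
  analytic1 (fun x => kappa b (f x)) p.
Proof.
move=> fp; have f2 : analytic1 (fun x => f x ^+ 2) p.
  by under eq_fun do rewrite expr2; apply: analytic1M.
have lp : analytic1 (fun x => kappa_lin b (f x)) p.
  apply: analytic1B => //; apply: analytic1D; first exact: analytic1_cst.
  by apply: analytic1M => //; exact: analytic1_cst.
have [w [wp w0 wE]] : exists w, [/\ analytic1 w p, w p = kappa b (f p) &
    \forall x \near p, w x ^+ 2 = kappa_lin b (f x) * w x + f x ^+ 2].
  apply: analytic1_quadratic => //; first exact: kappaE.
  by rewrite -subr_eq0 kappa_disc gt_eqF// sqrtr_gt0.
have cw := analytic1_continuous wp; rewrite w0 in cw; apply: analytic1_ext wp.
near=> x; apply: kappa_unique; last by near: x.
near: x; apply: (cvgr_gt (kappa b (f p)) cw); exact: kappa_gt0.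
Unshelve. all: by end_near.
Qed.

(** Replacing [s] and [K] by their inverses turns the equation for [b] into the one for [- b]. This
    relates the slope [y / x] to the slope [x / y] of the other chart. *)
Lemma kappa_inv b s : s != 0 -> kappa b s^-1 * kappa (- b) s = 1.
Proof.
move=> s0; have m0 := kappa_gt0 (- b) s; have mE := kappaE (- b) s.
have mn : kappa (- b) s != 0 by rewrite gt_eqF.
apply: (mulIf (invr_neq0 mn)); rewrite mulfK// mul1r; apply/esym/kappa_unique.
  by rewrite invr_gt0.
move: mE mn; set m := kappa (- b) s; rewrite /kappa_lin => mE mn.
(* Clearing denominators leaves the quadratic equation satisfied by [m]. *)
apply: (mulfI (_ : m ^+ 2 * s ^+ 2 != 0)); first by rewrite mulf_neq0 ?expf_neq0.
transitivity (s ^+ 2); first by field; rewrite ?s0 ?mn.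
transitivity (m ^+ 2 + (s ^+ 2 + 2 * b * s - 1) * m); last by field; rewrite ?s0 ?mn.
by rewrite mE; ring.
Qed.

(** The line of slope [s] is mapped to the line of slope [s / K]. There [1 / K] is positive and
    solves the equation for [- b]. *)
Lemma kappa_comp b s : kappa (- b) (s / kappa b s) * kappa b s = 1.
Proof.
have k0 := kappa_gt0 b s; have kE := kappaE b s.
have kn : kappa b s != 0 by rewrite gt_eqF.
apply: (mulIf (invr_neq0 kn)); rewrite mulfK// mul1r; apply/esym/kappa_unique.
  by rewrite invr_gt0.
move: kE kn; set k := kappa b s; rewrite /kappa_lin => kE kn.
apply: (mulfI (_ : k ^+ 3 != 0)); first by rewrite expf_neq0.
transitivity k; first by field.
transitivity (k ^+ 2 - 2 * b * s * k - s ^+ 2 + s ^+ 2 * k); last by field.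
by rewrite kE; ring.
Qed.

(** If the bound failed, both [K] and [K - kappa_lin b s] would exceed the absolute value of [s],
    although their product is [s^2]. The linear growth yields continuity of the shear at the
    origin. *)
Lemma kappa_le b s : kappa b s <= 1 + (2 * `|b| + 1) * `|s|.
Proof.
have [->|s0] := eqVneq s 0; first by rewrite kappa0 normr0 mulr0 addr0.
rewrite leNgt; apply/negP => h; have n0 : 0 < `|s| by rewrite normr_gt0.
have bs : 2 * b * s <= 2 * `|b| * `|s|.
  by rewrite -!mulrA ler_pM2l// -normrM ler_norm.
have k1 : `|s| < kappa b s.
  apply: le_lt_trans h; rewrite mulrDl mul1r addrA lerDr addr_ge0// !mulr_ge0//.
have k2 : `|s| < kappa b s - kappa_lin b s.
  rewrite /kappa_lin; have := sqr_ge0 s; lra.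
have : `|s| * `|s| < (kappa b s - kappa_lin b s) * kappa b s.
  by apply: ltr_pM.
by rewrite mulrBl -!expr2 kappaE addrC addKr real_normK ?num_real// ltxx.
Qed.

(* [X = shearx b x y] is the solution of [X - y^2 / X = x - y^2 / x + 2 b y] of
   the sign of [x]; hence the inverse is given by [- b]. At [x = 0] the value is
   the right one, namely [0]. *)
Definition shearx b x y := x * kappa b (y / x).

(** This expression in the slope [x / y] remains analytic across the axis [x = 0]. *)
Lemma shearx_inv b x y : y != 0 -> shearx b x y = x / kappa (- b) (x / y).
Proof.
move=> y0; have [->|x0] := eqVneq x 0; first by rewrite /shearx !mul0r.
have xy : x / y != 0 by rewrite mulf_neq0// invr_eq0.
rewrite /shearx -[y / x]invf_div; congr (_ * _).
apply: (mulIf (lt0r_neq0 (kappa_gt0 (- b) (x / y)))).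
by rewrite kappa_inv// mulVf// gt_eqF ?kappa_gt0.
Qed.

Lemma shearxZ b (c : R) x y : shearx b (c * x) (c * y) = c * shearx b x y.
Proof.
have [->|c0] := eqVneq c 0; first by rewrite /shearx !mul0r.
by rewrite /shearx -mulrA; congr (_ * (_ * kappa b _)); rewrite invfM mulrACA divff// mul1r.
Qed.

Lemma shearxK b y : cancel (shearx b ^~ y) (shearx (- b) ^~ y).
Proof.
move=> x; have [->|x0] := eqVneq x 0; first by rewrite /shearx !mul0r.
rewrite /shearx; have := kappa_comp b (y / x); move: (kappa b (y / x)) => k h.
have -> : y / (x * k) = y / x / k by rewrite invfM mulrA.
by rewrite -mulrA [k * _]mulrC h mulr1.
Qed.

Lemma norm_shearx_le b x y : `|shearx b x y| <= `|x| + (2 * `|b| + 1) * `|y|.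
Proof.
have [->|x0] := eqVneq x 0.
  by rewrite /shearx mul0r normr0 add0r mulr_ge0// addr_ge0// mulr_ge0.
rewrite /shearx normrM (gtr0_norm (kappa_gt0 _ _)).
apply: le_trans (ler_wpM2l (normr_ge0 x) (kappa_le b (y / x))) _.
rewrite mulrDr mulr1 lerD2l mulrCA ler_wpM2l ?addr_ge0 ?mulr_ge0//.
by rewrite normrM normfV mulrCA divff ?mulr1// normr_eq0.
Qed.

(** This rests on the identity [(K - 1 - 2 s) (K + s^2) = - 2 s^3], whose second factor is at least
    [1]. *)
Lemma kappa1_expansion s : 0 <= s -> s <= 1 -> `|kappa 1 s - 1 - 2 * s| <= 2 * s ^+ 3.
Proof.
move=> s0 s1; have k0 := kappa_gt0 1 s; have kE := kappaE 1 s.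
(* If [K < 1], then [K (1 - K) > 0], whereas the equation gives
   [K (1 - K) = - (2 s - s^2) K - s^2 <= 0]. *)
have k1 : 1 <= kappa 1 s.
  rewrite leNgt; apply/negP => kl; move: kE; rewrite /kappa_lin.
  have ss : s ^+ 2 <= s by rewrite expr2 ler_piMl.
  have : 0 <= (2 * s - s ^+ 2) * kappa 1 s by apply: mulr_ge0; [lra|exact: ltW].
  have : 0 < kappa 1 s * (1 - kappa 1 s) by rewrite mulr_gt0// subr_gt0.
  by have := sqr_ge0 s; lra.
have h : (kappa 1 s - 1 - 2 * s) * (kappa 1 s + s ^+ 2) = - (2 * s ^+ 3).
  rewrite mulrDr mulrBl mulrBl -expr2 kE /kappa_lin; ring.
have s3 : 0 <= s ^+ 3 by rewrite exprn_ge0.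
rewrite (_ : 2 * s ^+ 3 = `|- (2 * s ^+ 3)|); last by rewrite normrN ger0_norm// mulr_ge0.
rewrite -h normrM ler_peMr//.
by rewrite ger0_norm; have := sqr_ge0 s; lra.
Qed.
End Shear.

(** * Products of functions of one coordinate *)

Section SeparableAnalytic.
Context {R : realType}.

Lemma near_coord n (p : 'rV[R]_n) (r : 'I_n -> R) : (forall i, 0 < r i) ->
  \forall x \near (p : 'rV[R]_n), forall i, `|(x : 'rV[R]_n) 0 i - p 0 i| <= r i.
Proof.
move=> r0; apply: (@filter_forall 'rV[R]_n 'I_n
  (fun i x => `|x 0 i - p 0 i| <= r i) (nbhs p) _) => i.
have := @coord_continuous R 1 n 0 i p; move/cvgrPdist_le => /(_ _ (r0 i)).
by apply: filterS => x /=; rewrite distrC.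
Qed.

Lemma cvg_prod_ord n (f : 'I_n -> R^nat) (l : 'I_n -> R) :
  (forall i, f i @ \oo --> l i) ->
  (fun N => \prod_(i < n) f i N) @ \oo --> \prod_(i < n) l i.
Proof.
move=> fl; apply: cvg_big => [|i _]; [exact: mul_continuous|exact: fl].
Qed.

(** Summing over cubes of multi-indices makes the partial sum factor by distributivity. *)
Lemma mpseries_prod n (a : 'I_n -> R^nat) (z : 'rV[R]_n) N :
  mpseries (fun k => \prod_(i < n) a i (k i)) z N = \prod_(i < n) pseries (a i) (z 0 i) N.
Proof.
rewrite /mpseries /pseries /series /=.
under [RHS]eq_bigr do rewrite big_mkord.
rewrite bigA_distr_bigA /=; apply: eq_bigr => k _; rewrite -big_split /=.
by apply: eq_bigr => i _; rewrite ffunE.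
Qed.

Lemma analytic_at_prod n (u : 'I_n -> R -> R) (p : 'rV[R]_n) :
  (forall i, analytic1 (u i) (p 0 i)) ->
  analytic_at (fun x => \prod_(i < n) u i (x 0 i)) p.
Proof.
move=> up; have /choice[a /choice[r /choice[M aP]]] := up.
exists (fun k => \prod_(i < n) a i (k i)).
have r0 i : 0 < r i by have [] := aP i.
apply: filterS (near_coord p r0) => x xr; split.
  rewrite (_ : mpseries _ _ = (fun N =>
      \prod_(i < n) pseries (fun k => `|a i k|) `|x 0 i - p 0 i| N)).
    apply/cvg_ex; eexists; apply: cvg_prod_ord => i; have [_ aM _] := aP i.
    apply: (@abs_bound_cvg _ _ _ (M i)) => //; exact: abs_bound_le aM.
  apply/funext => N.
  transitivity (mpseries (fun k => \prod_(i < n) `|a i (k i)|)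
      (map_mx Num.norm (x - p)) N).
    by congr (mpseries _ _ N); apply/funext => k; rewrite normr_prod.
  rewrite (mpseries_prod (fun i k => `|a i k|)).
  by apply: eq_bigr => i _; rewrite !mxE.
rewrite (_ : mpseries _ _ = (fun N => \prod_(i < n) pseries (a i) (x 0 i - p 0 i) N)).
  apply: cvg_prod_ord => i; have [_ aM ua] := aP i.
  have := ua _ (xr i); rewrite addrC subrK => ->.
  exact: psum_cvg aM (xr i).
by apply/funext => N; rewrite mpseries_prod; apply: eq_bigr => i _; rewrite !mxE.
Qed.

Definition other (i : 'I_2) : 'I_2 := lift i (ord0 : 'I_1).

Lemma other_neq i : other i != i.
Proof. by rewrite eq_sym neq_lift. Qed.

Lemma ord2_other i j : j != i -> j = other i.
Proof. by move: i j => [[|[|//]] ?] [[|[|//]] ?] //= _; apply/val_inj. Qed.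

Lemma ord2P (i : 'I_2) : i = 0 \/ i = 1.
Proof. by case: i => [[|[|//]] ?]; [left|right]; apply/val_inj. Qed.

(** The coordinate expressions of the lifted maps, of the blowing-down and of its inverse all have
    this shape. *)
Lemma analytic_at_mul2 (i : 'I_2) (u w : R -> R) (p : 'rV[R]_2) :
  analytic1 u (p 0 i) -> analytic1 w (p 0 (other i)) ->
  analytic_at (fun x : 'rV[R]_2 => u (x 0 i) * w (x 0 (other i))) p.
Proof.
move=> up wp.
rewrite (_ : (fun x : 'rV[R]_2 => _) = (fun x : 'rV[R]_2 =>
    \prod_(j < 2) (if j == i then u else w) (x 0 j))).
  apply: (@analytic_at_prod _ (fun j => if j == i then u else w)) => j.
  by case: ifPn => [/eqP -> //|/ord2_other -> //].
apply/funext => x; rewrite (bigD1_ord i)//= eqxx; congr (_ * _).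
by rewrite big_ord1 (negbTE (other_neq i)).
Qed.
End SeparableAnalytic.

(** * The blowing-up of the plane *)

Section Blowup.
Context {R : realType}.

Lemma cvg_mx m n T (F : set_system T) (FF : Filter F) (f : T -> 'M[R]_(m, n))
    (l : 'M[R]_(m, n)) :
  (forall i j, f x i j @[x --> F] --> l i j) -> f @ F --> l.
Proof.
move=> h A [P lP PA].
suff : \forall x \near F, forall i j, P i j (f x i j).
  by apply: filterS => x Px; exact: PA.
apply: filter_forall => i; apply: filter_forall => j.
exact: (h i j _ (lP i j)).
Qed.

Lemma cvg_set_val (X : topologicalType) (A : set X) T (F : set_system T)
    (FF : Filter F) (f : T -> set_type A) (z : set_type A) :
  set_val (f x) @[x --> F] --> set_val z -> f @ F --> z.
Proof.
move=> cf U [? /= [[W oW <-]]] /= Wz /filterS; apply.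
by apply: cf; exact: open_nbhs_nbhs.
Qed.

Local Notation M := (set_type (@blowup_set R 2 predT)).

Definition sqn (v : 'rV[R]_2) := \sum_(i < 2) v 0 i ^+ 2.

(** For [v] nonzero, this is the orthogonal projection onto the line spanned by [v]. *)
Definition line_mx (v : 'rV[R]_2) : 'M[R]_2 :=
  \matrix_(i, j) (v 0 i * v 0 j / sqn v).

Lemma sqnE i v : sqn v = v 0 i ^+ 2 + v 0 (other i) ^+ 2.
Proof. by rewrite /sqn (bigD1_ord i)//= big_ord1. Qed.

Lemma row2P i (x y : 'rV[R]_2) : x 0 i = y 0 i ->
  x 0 (other i) = y 0 (other i) -> x = y.
Proof.
by move=> xi xo; apply/rowP => j; have [-> //|/ord2_other ->] := eqVneq j i.
Qed.

Lemma row2_neq0 (v : 'rV[R]_2) : v != 0 -> exists i, v 0 i != 0.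
Proof.
move=> v0; apply/existsP; apply: contraNT v0 => /existsPn h.
by apply/eqP/rowP => i; rewrite mxE; have := h i; rewrite negbK => /eqP.
Qed.

Lemma neq0_row2 (v : 'rV[R]_2) i : v 0 i != 0 -> v != 0.
Proof. by apply: contra_neq => ->; rewrite mxE. Qed.

Lemma sqn_neq0 v : v != 0 -> sqn v != 0.
Proof.
move=> /row2_neq0[i vi]; rewrite (sqnE i) gt_eqF// ltr_wpDr ?sqr_ge0//.
by rewrite lt0r sqrf_eq0 vi sqr_ge0.
Qed.

Lemma blowup_set_line (c : R) v : v != 0 ->
  @blowup_set R 2 predT (c *: v, line_mx v).
Proof.
move=> /sqn_neq0 s0; split => //=.
- by apply/matrixP => i j; rewrite !mxE [v 0 j * _]mulrC.
- apply/matrixP => i j; rewrite !mxE.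
  transitivity (\sum_k (v 0 i * v 0 j / sqn v ^+ 2) * v 0 k ^+ 2).
    by apply: eq_bigr => k _; rewrite !mxE; field.
  by rewrite -mulr_sumr -/(sqn v); field.
- rewrite /mxtrace; under eq_bigr do rewrite mxE -expr2.
  by rewrite -mulr_suml divff.
- apply/rowP => j; rewrite !mxE.
  transitivity (\sum_k (c * v 0 j / sqn v) * v 0 k ^+ 2).
    by apply: eq_bigr => k _; rewrite !mxE /=; field.
  by rewrite -mulr_sumr -/(sqn v); field.
Qed.

(** A spanning vector of the line with affine coordinate [s] in the chart [i] of the projective
    line. *)
Definition dirv (i : 'I_2) (s : R) : 'rV[R]_2 := \row_j (if j == i then 1 else s).

Lemma dirv_i i s : dirv i s 0 i = 1. Proof. by rewrite mxE eqxx. Qed.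

Lemma dirv_o i s : dirv i s 0 (other i) = s.
Proof. by rewrite mxE (negbTE (other_neq i)). Qed.

Lemma dirv_neq0 i s : dirv i s != 0.
Proof. by apply: (@neq0_row2 _ i); rewrite dirv_i oner_eq0. Qed.

(* The point [(c v, R v)] of the blowing-up; junk if [v = 0]. *)
Definition bpt (c : R) (v : 'rV[R]_2) : M :=
  insubd (exist (fun z => z \in @blowup_set R 2 predT) _
    (mem_set (blowup_set_line 0 (dirv_neq0 0 0))) : M)
    (c *: v, line_mx v).

Lemma bptE c v : v != 0 -> set_val (bpt c v) = (c *: v, line_mx v).
Proof. by move=> v0; rewrite set_valE insubdK//; apply/mem_set/blowup_set_line. Qed.

Lemma bpt_point c v : v != 0 -> blowup_point (bpt c v) = c *: v.
Proof. by move=> v0; rewrite /blowup_point bptE. Qed.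

Lemma bpt_line c v : v != 0 -> blowup_line (bpt c v) = line_mx v.
Proof. by move=> v0; rewrite /blowup_line bptE. Qed.

Lemma bptZ c k v : k != 0 -> v != 0 -> bpt c (k *: v) = bpt (c * k) v.
Proof.
move=> k0 v0; have kv0 : k *: v != 0 by rewrite scaler_eq0 negb_or k0.
apply: val_inj; rewrite [LHS]bptE// [RHS]bptE// scalerA; congr (_, _).
have sE : sqn (k *: v) = k ^+ 2 * sqn v.
  by rewrite /sqn mulr_sumr; apply: eq_bigr => i _; rewrite mxE exprMn.
by apply/matrixP => i j; rewrite !mxE sE; field; rewrite k0 sqn_neq0.
Qed.

Lemma blowup_line_diag (z : M) : exists i, blowup_line z i i != 0.
Proof.
apply/existsP; apply: contraT => /existsPn h.
have [_ _ + _ _] := set_valP z; rewrite /mxtrace big1.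
  by move/esym/eqP; rewrite oner_eq0.
by move=> i _; have := h i; rewrite negbK => /eqP.
Qed.

(** A symmetric idempotent matrix of trace [1] is the projection onto the line spanned by any
    nonzero row, here row [i]; the incidence condition puts the point on this line. *)
Lemma bpt_chart (z : M) i : blowup_line z i i != 0 ->
  z = bpt (blowup_point z 0 i)
        (dirv i (blowup_line z i (other i) / blowup_line z i i)).
Proof.
move=> a0; apply: val_inj; rewrite [RHS]bptE ?dirv_neq0//.
have [sym idem tr _ inc] := set_valP z.
rewrite -/(blowup_line z) -/(blowup_point z) in sym idem tr inc *.
rewrite [LHS]surjective_pairing -/(blowup_line z) -/(blowup_point z).
move: (blowup_line z) (blowup_point z) a0 sym idem tr inc => P x.
have sum2 (f : 'I_2 -> R) : \sum_k f k = f i + f (other i).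
  by rewrite (bigD1_ord i)//= big_ord1.
move=> a0 sym idem tr inc.
have bE : P (other i) i = P i (other i).
  by rewrite -{1}sym mxE.
move: tr; rewrite /mxtrace sum2 => tr.
have ii : P i i ^+ 2 + P i (other i) ^+ 2 = P i i.
  by move/matrixP: idem => /(_ i i); rewrite mxE sum2 bE => e; rewrite -[RHS]e !expr2.
have xo : x 0 i * P i (other i) + x 0 (other i) * P (other i) (other i) = x 0 (other i).
  by move/rowP: inc => /(_ (other i)); rewrite mxE sum2 !mxE.
(* The determinant of [P] vanishes, by the trace condition and a diagonal entry of [P P = P]. *)
have b2 : P i (other i) ^+ 2 = P i i * P (other i) (other i).
  by rewrite -[P (other i) (other i)](addKr (P i i)) tr; lra.
have sqE : sqn (dirv i (P i (other i) / P i i)) = (P i i)^-1.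
  rewrite (sqnE i) dirv_i dirv_o; apply: (mulIf (_ : P i i ^+ 2 != 0)).
    by rewrite expf_neq0.
  by rewrite exprMn mulrDl expr1n mul1r -mulrA exprVn mulVf ?expf_neq0// mulr1 ii expr2 mulKf.
congr (_, _).
  apply: (row2P (i := i)); rewrite mxE ?dirv_i ?mulr1// dirv_o.
  apply: (mulIf a0); rewrite -mulrA divfK//.
  have -> : P i i = 1 - P (other i) (other i) by lra.
  by lra.
apply/matrixP => k l; rewrite !mxE sqE invrK.
have [-> |/ord2_other ->] := eqVneq k i; have [-> |/ord2_other ->] := eqVneq l i;
  rewrite ?eqxx ?(negbTE (other_neq i)) ?mul1r ?mulr1.
- by [].
- by rewrite divfK.
- by rewrite divfK.
- by apply: (mulfI a0); rewrite -b2; field.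
Qed.

(** This reduces identities between maps on the blowing-up to points [(c v, R v)]. *)
Lemma bptP (z : M) : exists c v, v != 0 /\ z = bpt c v.
Proof.
have [i zi] := blowup_line_diag z; exists (blowup_point z 0 i).
by exists (dirv i (blowup_line z i (other i) / blowup_line z i i)); split;
  [exact: dirv_neq0|exact: bpt_chart].
Qed.

Lemma chart_dom_bpt i c v : v != 0 ->
  chart_dom (blowup_chart (R := R) predT i) (bpt c v) <-> v 0 i != 0.
Proof.
move=> v0; rewrite /= bpt_line// mxE -expr2 mulf_eq0 invr_eq0 (negbTE (sqn_neq0 v0)).
by rewrite orbF sqrf_eq0.
Qed.

Lemma chart_map_bpt i j c (v : 'rV[R]_2) : v 0 i != 0 ->
  blowup_chart (R := R) predT i (bpt c v) 0 j =
  if j == i then c * v 0 i else v 0 j / v 0 i.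
Proof.
move=> vi; have v0 := neq0_row2 vi; rewrite mxE bpt_line// bpt_point// !mxE /=.
have [->//|ji] := eqVneq j i; field.
by rewrite vi sqn_neq0.
Qed.

Definition chart_inv i (x : 'rV[R]_2) : M := bpt (x 0 i) (dirv i (x 0 (other i))).

Lemma chart_invK i x : blowup_chart (R := R) predT i (chart_inv i x) = x.
Proof.
apply: (row2P (i := i)); rewrite chart_map_bpt ?dirv_i ?oner_eq0//.
  by rewrite eqxx mulr1.
by rewrite (negbTE (other_neq i)) dirv_o divr1.
Qed.

Lemma chart_mapK i z : chart_dom (blowup_chart (R := R) predT i) z ->
  chart_inv i (blowup_chart predT i z) = z.
Proof.
move=> zi; rewrite [RHS](bpt_chart zi) /chart_inv; congr (bpt _ (dirv _ _)).
  by rewrite mxE eqxx.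
by rewrite mxE other_neq.
Qed.

Lemma cvg_sqn T (F : set_system T) (FF : Filter F) (v : T -> 'rV[R]_2) l :
  v @ F --> l -> sqn (v x) @[x --> F] --> sqn l.
Proof.
move=> vl; have h i : v x 0 i ^+ 2 @[x --> F] --> l 0 i ^+ 2.
  have hi : v x 0 i @[x --> F] --> l 0 i.
    exact: (cvg_comp _ _ vl (@coord_continuous _ _ _ _ _ _)).
  by rewrite expr2; under eq_fun do rewrite expr2; exact: cvgM.
rewrite (sqnE 0); under eq_fun do rewrite (sqnE 0).
exact: cvgD.
Qed.

(** Eventually [v x] is nonzero, so that [bpt] takes its genuine value, whose entries are continuous
    in [c] and [v]. *)
Lemma cvg_bpt T (F : set_system T) (FF : Filter F) (c : T -> R)
    (v : T -> 'rV[R]_2) (c0 : R) (v0 : 'rV[R]_2) : v0 != 0 ->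
  c @ F --> c0 -> v @ F --> v0 -> bpt (c x) (v x) @[x --> F] --> bpt c0 v0.
Proof.
move=> v00 cc vv; apply: cvg_set_val; rewrite bptE//.
have vi i : v x 0 i @[x --> F] --> v0 0 i.
  exact: (cvg_comp _ _ vv (@coord_continuous _ _ _ _ _ _)).
have nv : \forall x \near F, v x != 0.
  have [i vi0] := row2_neq0 v00.
  have := vi i; move/cvgr_neq0 => /(_ vi0); apply: filterS => x.
  exact: neq0_row2.
have h1 : c x *: v x @[x --> F] --> c0 *: v0.
  apply: cvg_mx => i j; rewrite ord1 mxE; under eq_fun do rewrite mxE.
  exact: cvgM.
have h2 : line_mx (v x) @[x --> F] --> line_mx v0.
  apply: cvg_mx => i j; rewrite mxE; under eq_fun do rewrite mxE.
  apply: cvgM; first exact: cvgM.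
  apply: cvgV; first exact: sqn_neq0.
  exact: cvg_sqn.
have h3 : (c x *: v x, line_mx (v x)) @[x --> F] --> (c0 *: v0, line_mx v0).
  exact: cvg_pair h1 h2.
move=> U /h3 hU.
have hF : F [set x | U (c x *: v x, line_mx (v x))] by exact: hU.
suff : F [set x | U (set_val (bpt (c x) (v x)))] by [].
by apply: filterS2 hF nv => x /= + vx; rewrite bptE.
Qed.

Lemma chart_inv_continuous i : continuous (chart_inv i).
Proof.
move=> x; apply: (@cvg_bpt _ (nbhs x) _ (fun y : 'rV[R]_2 => y 0 i)
  (fun y => dirv i (y 0 (other i))) _ _ (dirv_neq0 _ _)).
  exact: coord_continuous.
apply: cvg_mx => k j; rewrite ord1 mxE; under eq_fun do rewrite mxE.
by case: ifP => _; [exact: cvg_cst|exact: coord_continuous].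
Qed.

Lemma blowup_point_continuous :
  continuous (@blowup_point R 2 predT : M -> 'rV[R]_2).
Proof.
move=> z; have h : continuous (fun z : M => set_val z) by exact: initial_continuous.
exact: (cvg_comp _ _ (h z) (@cvg_fst _ _ _ _ _)).
Qed.

Lemma blowup_line_continuous :
  continuous (@blowup_line R 2 predT : M -> 'M[R]_2).
Proof.
move=> z; have h : continuous (fun z : M => set_val z) by exact: initial_continuous.
exact: (cvg_comp _ _ (h z) (@cvg_snd _ _ _ _ _)).
Qed.

Lemma blowup_line_entry_continuous i j :
  continuous (fun z : M => blowup_line z i j).
Proof.
by move=> z; exact: (cvg_comp _ _ (@blowup_line_continuous z) (@coord_continuous _ _ _ _ _ _)).
Qed.

Lemma blowup_chart_continuous (i : 'I_2) (z : M) : chart_dom (blowup_chart (R := R) predT i) z ->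
  blowup_chart (R := R) predT i x @[x --> z] --> blowup_chart (R := R) predT i z.
Proof.
move=> zi; apply: (@cvg_mx _ _ M (nbhs z) (nbhs_filter z)) => k j.
rewrite ord1 mxE; under eq_fun do rewrite mxE.
case: ifP => _.
  apply: cvgM; first exact: blowup_line_entry_continuous.
  by apply: cvgV => //; exact: blowup_line_entry_continuous.
exact: (cvg_comp _ _ (@blowup_point_continuous z) (@coord_continuous _ _ _ _ _ _)).
Qed.

Lemma blowup_chart_dom_open (i : 'I_2) : open (chart_dom (blowup_chart (R := R) predT i)).
Proof.
rewrite openE => z /= zi; rewrite /interior.
have := @blowup_line_entry_continuous i i z; move/cvgr_neq0 => /(_ zi).
exact.
Qed.
End Blowup.

(** * Lifting conic maps to the blowing-up *)

Section ConicLift.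
Context {R : realType}.

Local Notation M := (@std_blowup R 2 predT).
Local Notation chart_ i := (@blowup_chart R 2 predT i : chart R 2 M).

Lemma dirv_decomp (i : 'I_2) (v : 'rV[R]_2) : v 0 i != 0 ->
  v = v 0 i *: dirv i (v 0 (other i) / v 0 i).
Proof.
by move=> vi; apply: (row2P (i := i)); rewrite mxE ?dirv_i ?mulr1// dirv_o mulrC divfK.
Qed.

Section Lift.
Variable F : 'rV[R]_2 -> 'rV[R]_2.
Hypothesis F_conic : forall (k : R) v, F (k *: v) = k *: F v.
Hypothesis F_neq0 : forall v, v != 0 -> F v != 0.
Hypothesis F_analytic : forall i j s, analytic1 (fun s => F (dirv i s) 0 j) s.

(** The map [(c v, R v) |-> (c F v, R F v)]. As [v] is determined only up to a scalar, it is
    normalised in a chart around [z]; [blift_bpt] shows that the choice is immaterial. *)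
Definition blift (z : M) : M :=
  let i : 'I_2 := if blowup_line z 0 0 != 0 then 0 else 1 in
  bpt (chart_ i z 0 i) (F (dirv i (chart_ i z 0 (other i)))).

Lemma blift_bpt c v : v != 0 -> blift (bpt c v) = bpt c (F v).
Proof.
move=> v0; rewrite /blift; set i := (X in chart_ X).
have vi : v 0 i != 0.
  apply/(chart_dom_bpt i c v0) => /=; rewrite /i; case: ifPn => // /negPn/eqP h.
  (* By the trace condition, the second diagonal entry is [1] when the first one vanishes. *)
  have [_ _ + _ _] := set_valP (bpt c v); rewrite -/(blowup_line _) /mxtrace.
  rewrite (bigD1_ord 0)//= big_ord1 h add0r => h1.
  have -> : (1 : 'I_2) = lift 0 (ord0 : 'I_1) by apply/val_inj.
  by rewrite h1 oner_eq0.
rewrite !chart_map_bpt// eqxx (negbTE (other_neq i)).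
by rewrite -bptZ// -?F_conic -?dirv_decomp// F_neq0// dirv_neq0.
Qed.

Lemma blift_chart i z : chart_dom (chart_ i) z ->
  blift z = bpt (chart_ i z 0 i) (F (dirv i (chart_ i z 0 (other i)))).
Proof.
by move=> zi; rewrite -{1}(chart_mapK zi) blift_bpt ?dirv_neq0.
Qed.

Lemma blift_point z : blowup_point (blift z) = F (blowup_point z).
Proof.
have [c [v [v0 ->]]] := bptP z.
by rewrite blift_bpt// !bpt_point ?F_neq0// F_conic.
Qed.

Lemma blift_continuous : continuous blift.
Proof.
move=> z; have [i zi] := blowup_line_diag z.
rewrite /continuous_at (blift_chart (i := i) zi).
have cz := blowup_chart_continuous zi.
have cc j : chart_ i x 0 j @[x --> z] --> chart_ i z 0 j.
  exact: (cvg_comp _ _ cz (@coord_continuous _ _ _ _ _ _)).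
suff : bpt (chart_ i x 0 i) (F (dirv i (chart_ i x 0 (other i)))) @[x --> z] -->
    bpt (chart_ i z 0 i) (F (dirv i (chart_ i z 0 (other i)))).
  move=> h U /h hU; have zd : nbhs z (chart_dom (chart_ i)).
    by apply: open_nbhs_nbhs; split => //; exact: blowup_chart_dom_open.
  have hF : nbhs z [set x | U (bpt (chart_ i x 0 i)
    (F (dirv i (chart_ i x 0 (other i)))))] by exact: hU.
  suff : nbhs z [set x | U (blift x)] by [].
  by apply: filterS2 hF zd => x /= Ux xi; rewrite (blift_chart (i := i) xi).
apply: (@cvg_bpt _ M (nbhs z) (nbhs_filter z) (fun x => chart_ i x 0 i)
  (fun x => F (dirv i (chart_ i x 0 (other i)))) _ _ (F_neq0 (dirv_neq0 _ _))).
  exact: cc.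
apply: (@cvg_mx _ _ _ M (nbhs z) (nbhs_filter z)) => k j; rewrite ord1.
exact: (cvg_comp _ _ (cc (other i)) (analytic1_continuous (F_analytic i j _))).
Qed.

Lemma blift_analytic z : analytic_map_at blift z.
Proof.
split; first exact: blift_continuous.
move=> _ _ [i _ <-] [j _ <-] zi zj.
pose u k s := F (dirv i s) 0 k.
(* From the chart [i] to the chart [j] the lift sends [(x, s)] to [(x u_j(s), u_k(s) / u_j(s))],
   where [k] is the index other than [j]. The factor [1] produces the shape of
   [analytic_at_mul2]. *)
exists (fun x => \row_k (if k == j then x 0 i * u j (x 0 (other i))
   else 1 * (u k (x 0 (other i)) / u j (x 0 (other i))))).
  have uj0 : u j (chart_ i z 0 (other i)) != 0.
    move: zj; rewrite (blift_chart (i := i) zi).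
    by move/chart_dom_bpt; apply; exact/F_neq0/dirv_neq0.
  move=> k; under [fun _ => _]eq_fun do rewrite mxE.
  have [_|kj] := eqVneq k j.
    apply: (@analytic_at_mul2 _ i id); first exact: analytic1_id.
    exact: F_analytic.
  apply: (@analytic_at_mul2 _ i (fun=> 1) (fun s => u k s / u j s)).
    exact: analytic1_cst.
  by apply: analytic1M; [exact: F_analytic|apply: analytic1V => //; exact: F_analytic].
have zd : nbhs z (chart_dom (chart_ i)).
  by apply: open_nbhs_nbhs; split => //; exact: blowup_chart_dom_open.
have zd' : nbhs z [set x | chart_dom (chart_ j) (blift x)].
  apply: (@blift_continuous z); apply: open_nbhs_nbhs; split => //.
  exact: blowup_chart_dom_open.
apply: filterS2 zd zd' => x xi xj.
have {}xj : chart_dom (chart_ j) (blift x) by exact: xj.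
rewrite (blift_chart (i := i) xi) in xj *.
have {}xj : u j (chart_ i x 0 (other i)) != 0.
  by move/chart_dom_bpt: xj; apply; exact/F_neq0/dirv_neq0.
apply/rowP => k; rewrite chart_map_bpt// [RHS]mxE.
by case: ifP => // _; rewrite mul1r.
Qed.
End Lift.

Lemma dirv_analytic i j (s : R) : analytic1 (fun s => dirv i s 0 j) s.
Proof.
under eq_fun do rewrite mxE.
by case: eqVneq => _; [exact: analytic1_cst|exact: analytic1_id].
Qed.

Lemma blift_id : blift id = id.
Proof.
by apply/funext => z; have [c [v [v0 ->]]] := bptP z; rewrite blift_bpt.
Qed.

(** The changes of charts are the case [F = id] of the lift. *)
Lemma idfun_analytic (z : M) : analytic_map_at (idfun : M -> M) z.
Proof.
have := @blift_analytic id (fun _ _ => erefl) (fun _ h => h) dirv_analytic z.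
by rewrite blift_id.
Qed.

Lemma set_type_hausdorff (X : topologicalType) (A : set X) :
  hausdorff_space X -> hausdorff_space (set_type A).
Proof.
move=> hX p q pq; apply: val_inj; apply: hX => U V pU qV.
have c : continuous (fun z : set_type A => set_val z) by exact: initial_continuous.
have [z [Uz Vz]] := pq _ _ (c p _ pU) (c q _ qV).
by exists (set_val z).
Qed.

Lemma std_blowup_hausdorff : hausdorff_space M.
Proof. by apply: set_type_hausdorff; exact: norm_hausdorff. Qed.

Lemma std_blowup_chart_image (i : 'I_2) (A : set M) : A `<=` chart_dom (chart_ i) ->
  chart_ i @` A = chart_inv i @^-1` A.
Proof.
move=> Ai; apply/seteqP; split => [_ [z Az <-]|x Ax].
  by rewrite /= (chart_mapK (Ai _ Az)).
by exists (chart_inv i x) => //; rewrite chart_invK.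
Qed.

Definition ratball n (qr : 'rV[rat]_n * rat) : set 'rV[R]_n :=
  ball (map_mx (@ratr R) qr.1 : 'rV[R]_n) (ratr qr.2 : R).

Lemma ratball_basis n (x : 'rV[R]_n) (U : set 'rV[R]_n) : nbhs x U ->
  exists qr : 'rV[rat]_n * rat, ratball qr x /\ ratball qr `<=` U.
Proof.
move=> /nbhs_ballP[e /= e0 eU].
have [r] : exists r : rat, (ratr r : R) \in `]0, e / 2[.
  by apply: rat_in_itvoo; rewrite divr_gt0.
rewrite in_itv /= => /andP[r0 re].
have /choice[q qP] : forall j : 'I_n, exists q : rat, `|ratr q - x 0 j| < ratr r.
  move=> j; have xr : x 0 j - ratr r < x 0 j + ratr r by lra.
  have [q] := rat_in_itvoo xr.
  by rewrite in_itv /= => qj; exists q; rewrite distrC ltr_distlC.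
exists (\row_j q j, r); split.
  by split => // k j; rewrite ord1 /= !mxE -ball_normE; exact: qP.
move=> y [_ yq]; apply: eU; split => // k j; rewrite ord1.
have := yq 0 j; rewrite !mxE -!ball_normE /= => h.
have h1 := lt_trans h re; have h2 := lt_trans (qP j) re; rewrite distrC in h2.
by rewrite [e]splitr; exact: le_lt_trans (ler_distD _ _ _) (ltrD h2 h1).
Qed.

(** The rational balls are pulled back by the two charts. *)
Lemma std_blowup_second_countable : @second_countable M.
Proof.
exists [set chart_dom (chart_ b.1) `&` chart_ b.1 @^-1` (ratball b.2)
  | b in [set: 'I_2 * ('rV[rat]_2 * rat)]].
  exact: card_le_trans (card_image_le _ _) (countableP _).
split.
  move=> _ [[i b] _ <-] /=; rewrite openE => z [/= zi zb]; apply: filterI.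
    by apply: open_nbhs_nbhs; split => //; exact: blowup_chart_dom_open.
  apply: (blowup_chart_continuous zi).
  by apply: open_nbhs_nbhs; split => //; exact: ball_open.
move=> z U zU; have [i zi] := blowup_line_diag z.
have zE : chart_inv i (chart_ i z) = z by exact: (chart_mapK (i := i) zi).
have : nbhs (chart_ i z) (chart_inv i @^-1` U).
  by apply: chart_inv_continuous; rewrite zE.
move=> /ratball_basis[b [bz bU]].
exists (chart_dom (chart_ i) `&` chart_ i @^-1` (ratball b)).
  by split; [exists (i, b)|split].
by move=> x [xi /bU]; rewrite /= (chart_mapK xi).
Qed.

Lemma std_blowup_manifold : is_analytic_manifold M.
Proof.
split.
- exact: std_blowup_hausdorff.
- exact: std_blowup_second_countable.
- by move=> z; have [i zi] := blowup_line_diag z; exists (chart_ i) => //; exists i.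
- move=> _ [i _ <-]; split.
  + exact: blowup_chart_dom_open.
  + move=> x y; rewrite !inE => xi yi xy.
    by rewrite -(chart_mapK xi) -(chart_mapK yi) xy.
  + by move=> z; rewrite inE => zi; exact: blowup_chart_continuous.
  + move=> A oA Ai; rewrite (std_blowup_chart_image Ai).
    by apply: open_comp => // x _; exact: chart_inv_continuous.
- exact: idfun_analytic.
Qed.
End ConicLift.

(** * The blowing-down and the homeomorphisms induced by conic maps *)

Section PlaneBlowup.
Context {R : realType}.

Local Notation M := (@std_blowup R 2 predT).
Local Notation E := (@euclidean R 2).
Local Notation U := (@open_subspace R 2 [set: 'rV[R]_2]).
Local Notation chart_ i := (@blowup_chart R 2 predT i : chart R 2 M).

Definition to_sub (x : 'rV[R]_2) : U := exist _ x (mem_set I).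

Lemma to_subK (q : U) : to_sub (set_val q) = q.
Proof. exact: val_inj. Qed.

Lemma set_val_continuous (q : U) : set_val x @[x --> q] --> set_val q.
Proof. exact: initial_continuous. Qed.

Lemma analytic_coord i (p : 'rV[R]_2) : analytic_at (fun x : 'rV[R]_2 => x 0 i) p.
Proof.
under eq_fun do rewrite -[_ 0 i]mulr1.
apply: (@analytic_at_mul2 _ i id (fun=> 1)); [exact: analytic1_id|exact: analytic1_cst].
Qed.

Lemma set_val_analytic (q : U) : analytic_map_at (set_val : U -> E) q.
Proof.
split; first exact: set_val_continuous.
move=> _ _ -> -> _ _; exists id; first by move=> i; exact: analytic_coord.
exact: filterE.
Qed.

Lemma to_sub_analytic (x : E) : analytic_map_at (to_sub : E -> U) x.
Proof.
split.
  by apply: (@cvg_set_val _ _ _ (nbhs x) (nbhs_filter x)); exact: cvg_id.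
move=> _ _ -> -> _ _; exists id; first by move=> i; exact: analytic_coord.
exact: filterE.
Qed.

Definition bdown (z : M) : U := to_sub (blowup_point z).

(** The inverse [x |-> (x, R x)] of the blowing-down off the origin; junk at the origin. *)
Definition bup (q : U) : M := bpt 1 (set_val q).

Lemma bdown_analytic z : analytic_map_at bdown z.
Proof.
split.
  apply: (@cvg_set_val _ _ M (nbhs z) (nbhs_filter z)).
  exact: (@blowup_point_continuous R z).
move=> _ _ [i _ <-] -> zi _.
exists (fun x => \row_k (if k == i then x 0 i * 1 else x 0 i * x 0 (other i))).
  move=> k; under [fun _ => _]eq_fun do rewrite mxE.
  have [_|_] := eqVneq k i.
    by apply: (@analytic_at_mul2 _ i id (fun=> 1)); [exact: analytic1_id|exact: analytic1_cst].
  by apply: (@analytic_at_mul2 _ i id id); exact: analytic1_id.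
have zd : nbhs z (chart_dom (chart_ i)).
  by apply: open_nbhs_nbhs; split => //; exact: blowup_chart_dom_open.
apply: filterS zd => x xi.
transitivity (blowup_point x) => //.
rewrite -{1}(chart_mapK xi) /chart_inv bpt_point ?dirv_neq0//.
move: (chart_map (chart_ i) x) => y; apply/rowP => k; rewrite !mxE.
by case: eqVneq.
Qed.

Lemma bup_analytic (q : U) : set_val q != 0 -> analytic_map_at bup q.
Proof.
move=> q0; have cq : bup x @[x --> q] --> bup q.
  apply: (@cvg_bpt _ U (nbhs q) (nbhs_filter q) (fun=> 1)
    (fun x : U => set_val x) _ _ q0); first exact: cvg_cst.
  exact: set_val_continuous.
split => // _ _ -> [j _ <-] _ qj.
exists (fun x => \row_k (if k == j then x 0 j * 1 else (x 0 j)^-1 * x 0 (other j))).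
  have qj0 : set_val q 0 j != 0 by apply/(chart_dom_bpt j 1 q0).
  move=> k; under [fun _ => _]eq_fun do rewrite mxE.
  have [_|_] := eqVneq k j.
    by apply: (@analytic_at_mul2 _ j id (fun=> 1)); [exact: analytic1_id|exact: analytic1_cst].
  apply: (@analytic_at_mul2 _ j (fun s => s^-1) id); last exact: analytic1_id.
  by apply: analytic1V => //; exact: analytic1_id.
have qd : nbhs q [set x | chart_dom (chart_ j) (bup x)].
  apply: cq; apply: open_nbhs_nbhs; split => //; exact: blowup_chart_dom_open.
have qn : nbhs q [set x : U | set_val x != 0].
  have [i qi] := row2_neq0 q0.
  have ci : set_val (x : U) 0 i @[x --> q] --> set_val q 0 i.
    exact: (cvg_comp _ _ (@set_val_continuous q) (@coord_continuous _ _ _ _ _ _)).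
  move/cvgr_neq0 : ci => /(_ qi); apply: filterS => x; exact: neq0_row2.
apply: filterS2 qd qn => x /= + x0; move/(chart_dom_bpt j 1 x0) => xj.
apply/rowP => k; rewrite chart_map_bpt// mxE.
by case: eqVneq => [_|/ord2_other ->]; [rewrite mul1r mulr1|rewrite mulrC].
Qed.

Lemma bupK (q : U) : set_val q != 0 -> bdown (bup q) = q.
Proof. by move=> q0; rewrite /bdown bpt_point// scale1r to_subK. Qed.

Lemma bdownK (z : M) : blowup_point z != 0 -> bup (bdown z) = z.
Proof.
have [c [v [v0 ->]]] := bptP z; rewrite bpt_point// => cv0.
have c0 : c != 0 by apply: contraNneq cv0 => ->; rewrite scale0r.
have bE : set_val (bdown (bpt c v)) = c *: v by exact: bpt_point.
by rewrite /bup bE bptZ// mul1r.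
Qed.

Lemma openT_diffeo : analytic_diffeo_on [set: U] [set: E] (set_val : U -> E).
Proof.
split; [exact: openT|exact: openT| |by move=> q _; exact: set_val_analytic|].
  by split.
exists to_sub; first by move=> q _; exact: to_subK.
by move=> x _; exact: to_sub_analytic.
Qed.

Lemma bdown_blowing_up :
  is_blowing_up [set q : U | set_val q = 0] bdown.
Proof.
have cC : closed [set q : U | set_val q = 0].
  have h : closed [set (0 : 'rV[R]_2)].
    by apply: accessible_closed_set1; apply: hausdorff_accessible; exact: norm_hausdorff.
  have := @closed_comp U _ (fun q : U => set_val q) _ _ h.
  by apply => q _; exact: set_val_continuous.
split => //.
- split.
  + apply: open_comp; first by move=> z _; have [] := bdown_analytic z.
    exact: closed_openC.
  + exact: closed_openC.
  + split.
    * by move=> z.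
    * move=> x y; rewrite !inE /= => /eqP x0 /eqP y0 xy.
      by rewrite -(bdownK x0) -(bdownK y0) xy.
    * move=> q /eqP q0; exists (bup q); last exact: bupK.
      by rewrite /= bupK//; exact/eqP.
  + by move=> z _; exact: bdown_analytic.
  + exists bup; first by move=> z; rewrite inE /= => /eqP; exact: bdownK.
    by move=> q /eqP; exact: bup_analytic.
(* The plane is itself the standard model, so that the local isomorphism is global: the coordinates
   are the inclusion, both coordinates are blown up, and [Psi] is the identity. *)
- move=> q q0; exists setT, setT, (set_val : U -> E), (predT : {pred 'I_2}), (idfun : M -> M).
  split => //.
  + by exists ord0.
  + exact: openT_diffeo.
  + move=> x _; have -> : coord_part predT (set_val x) = set_val x.
      by apply/rowP => j; rewrite mxE.
    by [].
  + split=> //; rewrite !preimage_setT; split; [exact: openT|exact: openT| | |].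
    * by split.
    * by move=> z _; exact: idfun_analytic.
    * by exists idfun => // z _; exact: idfun_analytic.
Qed.

Lemma bdown_seq : blowing_up_seq (id \o bdown : M -> U).
Proof.
exact: blowing_up_cons (blowing_up_nil _) (std_blowup_manifold) bdown_blowing_up.
Qed.

Section ConicHomeo.
Variables F G : 'rV[R]_2 -> 'rV[R]_2.
Hypothesis F_conic : forall (k : R) v, F (k *: v) = k *: F v.
Hypothesis F_analytic : forall i j s, analytic1 (fun s => F (dirv i s) 0 j) s.
Hypothesis F_lim0 : F x @[x --> (0 : 'rV[R]_2)] --> (0 : 'rV[R]_2).
Hypothesis FK : cancel F G.

Lemma conic0 : F 0 = 0.
Proof. by rewrite -(scale0r (0 : 'rV[R]_2)) F_conic !scale0r. Qed.

Lemma conic_neq0 v : v != 0 -> F v != 0.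
Proof.
by apply: contra_neq => v0; rewrite -(FK v) v0 -{1}conic0 FK.
Qed.

(** Off the origin [F] is the composite of [x |-> (x, R x)], the continuous lift and the
    blowing-down; at the origin continuity is the hypothesis [F_lim0]. *)
Lemma conic_continuous : continuous F.
Proof.
move=> x; have [->|x0] := eqVneq x 0; first by rewrite /continuous_at conic0.
have h : blowup_point (blift F (bpt 1 y)) @[y --> x] --> blowup_point (blift F (bpt 1 x)).
  have c1 : bpt 1 y @[y --> x] --> bpt 1 x.
    by apply: (@cvg_bpt _ _ (nbhs x) _ (fun=> 1) id _ _ x0); [exact: cvg_cst|exact: cvg_id].
  have c2 := cvg_comp _ _ c1 (@blift_continuous _ _ F_conic conic_neq0 F_analytic (bpt 1 x)).
  exact: (cvg_comp _ _ c2 (@blowup_point_continuous R (blift F (bpt 1 x)))).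
have E y : y != 0 -> blowup_point (blift F (bpt 1 y)) = F y.
  by move=> y0; rewrite blift_point// ?bpt_point ?scale1r//; exact: conic_neq0.
rewrite /continuous_at -E// => V /h hV.
have hF : nbhs x [set y | V (blowup_point (blift F (bpt 1 y)))] by exact: hV.
have xn : nbhs x [set y : 'rV[R]_2 | y != 0].
  have [i xi] := row2_neq0 x0.
  have := @coord_continuous R 1 2 0 i x; move/cvgr_neq0 => /(_ xi).
  by apply: filterS => y; exact: neq0_row2.
suff : nbhs x [set y | V (F y)] by [].
by apply: filterS2 hF xn => y /= + y0; rewrite E.
Qed.
End ConicHomeo.

(** The lifts of [F] and [G] are inverse to each other, as seen on the points [(c v, R v)], and one
    blowing-up of the origin on each side suffices. *)
Lemma conic_blow_analytic (F G : 'rV[R]_2 -> 'rV[R]_2) :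
  (forall (k : R) v, F (k *: v) = k *: F v) ->
  (forall (k : R) v, G (k *: v) = k *: G v) ->
  (forall i j s, analytic1 (fun s => F (dirv i s) 0 j) s) ->
  (forall i j s, analytic1 (fun s => G (dirv i s) 0 j) s) ->
  F x @[x --> (0 : 'rV[R]_2)] --> (0 : 'rV[R]_2) ->
  G x @[x --> (0 : 'rV[R]_2)] --> (0 : 'rV[R]_2) ->
  cancel F G -> cancel G F ->
  analytic_diffeo (blift F) /\ blow_analytic_homeo setT setT F.
Proof.
move=> Fc Gc Fa Ga F0 G0 FK GK.
have Fn := conic_neq0 Fc FK; have Gn := conic_neq0 Gc GK.
have FKl : cancel (blift F) (blift G).
  by move=> z; have [c [v [v0 ->]]] := bptP z; rewrite !blift_bpt ?Fn// FK.
have GKl : cancel (blift G) (blift F).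
  by move=> z; have [c [v [v0 ->]]] := bptP z; rewrite !blift_bpt ?Gn// GK.
have D : analytic_diffeo (blift F).
  split; [exact: openT|exact: openT| | |].
  - split => //; first by move=> x y _ _; exact: (can_inj FKl).
    by move=> z _; exists (blift G z).
  - by move=> z _; exact: blift_analytic.
  - exists (blift G); first by move=> z _; exact: FKl.
    by move=> z _; exact: blift_analytic.
split=> //; split; [exact: openT|exact: openT| |].
- split.
  + split => //; first by move=> x y _ _; exact: (can_inj FK).
    by move=> x _; exists (G x).
  + exact/continuous_subspaceT/(conic_continuous Fc Fa F0 FK).
  + exists G; first by move=> x _; exact: FK.
    exact/continuous_subspaceT/(conic_continuous Gc Ga G0 GK).
- exists M, M, (id \o bdown), (id \o bdown), (blift F).
  split => //; [exact: bdown_seq|exact: bdown_seq|].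
  by move=> z; apply/esym; exact: blift_point.
Qed.
End PlaneBlowup.

(** * Action on arcs *)

Section Arcs.
Context {R : realType}.

Lemma analytic1X (f : R -> R) p n : analytic1 f p -> analytic1 (fun x => f x ^+ n) p.
Proof.
move=> fp; elim: n => [|n IH]; first exact: analytic1_cst.
by under eq_fun do rewrite exprS; exact: analytic1M.
Qed.

Lemma psum_factor (a : R^nat) (r M : R) m : 0 < r -> abs_bound a r M ->
  (forall k, (k < m)%N -> a k = 0) ->
  (exists N, abs_bound (fun k => a (m + k)%N) r N) /\
  forall z, `|z| <= r -> psum a z = z ^+ m * psum (fun k => a (m + k)%N) z.
Proof.
move=> r0; elim: m a M => [|m IH] a M aM am.
  by split=> [|z _]; [exists M|rewrite expr0 mul1r].
have [[N aN] aE] : (exists N, abs_bound (fun k => a (m + k).+1) r N) /\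
  forall z, `|z| <= r -> psum (fun k => a k.+1) z = z ^+ m * psum (fun k => a (m + k).+1) z.
  by apply: (IH (fun k => a k.+1)) (abs_bound_shift r0 aM) _ => k km; exact: am.
split; first by exists N.
by move=> z zr; rewrite (psum_recl r0 aM zr) am// add0r aE// mulrA -exprS.
Qed.

Lemma near_le_norm (r : R) : 0 < r -> \forall t \near (0 : R), `|t| <= r.
Proof.
move=> r0; apply/nbhs_ballP; exists r => //= t.
by rewrite -ball_normE /= sub0r normrN => /ltW.
Qed.

(** The exponent [m] is the index of the first nonzero coefficient. *)
Lemma germ_order (f : R -> R) : analytic1 f 0 ->
  (\forall t \near 0, f t = 0) \/
  exists m u, [/\ analytic1 u 0, u 0 != 0 & \forall t \near 0, f t = t ^+ m * u t].
Proof.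
move=> [a [r [M [r0 aM fa]]]].
have fE : \forall t \near 0, `|t| <= r /\ f t = psum a t.
  by apply: filterS (near_le_norm r0) => t tr; split => //; rewrite -fa// add0r.
have [[k ak]|a0] := pselect (exists k, a k != 0); last first.
  left; apply: filterS fE => t [_ ->]; rewrite (_ : a = fun=> 0) ?psum0//.
  apply/funext => k; apply/eqP/negPn/negP => ak; apply: a0; by exists k.
right; have [m am mmin] := ex_minnP (ex_intro (fun k => a k != 0) k ak).
have a0 k' : (k' < m)%N -> a k' = 0.
  by move=> k'm; apply/eqP/negPn/negP => /mmin; rewrite leqNgt k'm.
have [[N aN] aE] := psum_factor r0 aM a0.
exists m, (psum (fun k => a (m + k)%N)); split.
- by exists (fun k => a (m + k)%N), r, N; split => // z _; rewrite add0r.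
- by rewrite (psum_at0 r0 aN) addn0.
- by apply: filterS fE => t [tr ->]; exact: aE.
Qed.

Let germ_div_le (x y : R -> R) m n u v : analytic1 u 0 -> u 0 != 0 ->
  analytic1 v 0 -> (m <= n)%N ->
  (\forall t \near 0, x t = t ^+ m * u t) ->
  (\forall t \near 0, y t = t ^+ n * v t) ->
  exists2 s, analytic1 s 0 & \forall t \near 0, y t = x t * s t.
Proof.
move=> ua u0 va mn xE yE; exists (fun t => t ^+ (n - m) * (v t / u t)).
  apply: analytic1M; first by apply: analytic1X; exact: analytic1_id.
  by apply: analytic1M => //; exact: analytic1V.
have un : \forall t \near (0 : R), u t != 0.
  have cu := analytic1_continuous ua.
  exact: (cvgr_neq0 _ cu u0).
near=> t; have -> : x t = t ^+ m * u t by near: t.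
have -> : y t = t ^+ n * v t by near: t.
have u0' : u t != 0 by near: t.
by rewrite -{1}(subnKC mn) exprD; field.
Unshelve. all: by end_near.
Qed.

(** Germs in one variable form a discrete valuation ring: the germ of smaller order divides the
    other. *)
Lemma germ_div (x y : R -> R) : analytic1 x 0 -> analytic1 y 0 ->
  (exists2 s, analytic1 s 0 & \forall t \near 0, y t = x t * s t) \/
  (exists2 s, analytic1 s 0 & \forall t \near 0, x t = y t * s t).
Proof.
move=> /germ_order[x0|[m [u [ua u0 xE]]]].
  right; exists (fun=> 0); first exact: analytic1_cst.
  by apply: filterS x0 => t ->; rewrite mulr0.
move=> /germ_order[y0|[n [v [va v0 yE]]]].
  left; exists (fun=> 0); first exact: analytic1_cst.
  by apply: filterS y0 => t ->; rewrite mulr0.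
by have [mn|/ltnW nm] := leqP m n; [left; exact: (germ_div_le ua u0 va mn)
  |right; exact: (germ_div_le va v0 ua nm)].
Qed.

(** One of the slopes [y / x] and [x / y] extends to an analytic germ [s], that is, the arc lifts to
    the blowing-up. The shear is then given by [kappa b (s t)] or by the inverse of
    [kappa (- b) (s t)]. *)
Lemma shearx_germ b (x y : R -> R) : analytic1 x 0 -> analytic1 y 0 ->
  exists2 w, analytic1 w 0 & \forall t \near 0, w t = shearx b (x t) (y t).
Proof.
move=> xa ya; have [[s sa yE]|[s sa xE]] := germ_div xa ya.
  exists (fun t => x t * kappa b (s t)); first by apply: analytic1M => //; exact: analytic1_kappa.
  apply: filterS yE => t ->; rewrite /shearx; have [->|x0] := eqVneq (x t) 0.
    by rewrite !mul0r.
  by rewrite mulrAC divff// mul1r.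
exists (fun t => x t / kappa (- b) (s t)).
  apply: analytic1M => //; apply: analytic1V; last exact: analytic1_kappa.
  by rewrite gt_eqF// kappa_gt0.
apply: filterS xE => t ->; have [->|y0] := eqVneq (y t) 0.
  by rewrite /shearx !mul0r.
by rewrite shearx_inv// [y t * s t / y t]mulrAC divff// mul1r.
Qed.

(** Convergence at [r] implies absolute convergence at [r / 2]. *)
Lemma convergent_abs_bound (a : R^nat) : convergent_series a ->
  exists r M, 0 < r /\ abs_bound a r M.
Proof.
move=> [r r0 ar]; have r2 : 0 < r / 2 by rewrite divr_gt0.
have : cvgn (pseries (fun k => `|a k|) (r / 2)).
  apply: is_cvg_pseries_inside_norm ar _.
  by rewrite !gtr0_norm// ltr_pdivrMr// mulr_natr mulr2n ltrDl.
move=> h; exists (r / 2), (psum (fun k => `|a k|) (r / 2)); split => // n.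
apply: (nondecreasing_cvgn_le _ h n).
by apply: nondecreasing_series => k _ _; rewrite mulr_ge0// exprn_ge0// ltW.
Qed.

Lemma abs_bound_convergent (a : R^nat) (r M : R) : 0 < r -> abs_bound a r M ->
  convergent_series a.
Proof.
by move=> r0 aM; exists r => //; apply: abs_bound_is_cvg aM _; rewrite gtr0_norm.
Qed.

Lemma convergent_analytic1 (a : R^nat) : convergent_series a -> analytic1 (psum a) 0.
Proof.
move=> /convergent_abs_bound[r [M [r0 aM]]].
by exists a, r, M; split => // z _; rewrite add0r.
Qed.

Definition shear b (v : 'rV[R]_2) := point2 (shearx b (v 0 0) (v 0 1)) (v 0 1).

Lemma shear_arc b (c : set_type (@arc_germs R 2)) :
  exists c' : set_type (@arc_germs R 2),
    \forall t \near (0 : R)^'+, shear b (arc_eval c t) = arc_eval c' t.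
Proof.
have [] := set_valP c; rewrite -set_valE => c0 cc.
have [w wa wE] := shearx_germ b (convergent_analytic1 (cc 0)) (convergent_analytic1 (cc 1)).
have [d [r [M [r0 dM wd]]]] := wa.
have w0 : w 0 = 0.
  rewrite (nbhs_singleton wE) /shearx.
  have [r' [M' [r'0 cM]]] := convergent_abs_bound (cc 0).
  by rewrite (psum_at0 r'0 cM) c0 mxE mul0r.
have d0 : d 0%N = 0 by rewrite -(psum_at0 r0 dM) -wd ?addr0// normr0 ltW.
pose c' : prod_topology (fun _ : nat => 'rV[R]_2) := fun k => point2 (d k) (set_val c k 0 1).
have c'0 : (fun k => c' k 0 0) = d by apply/funext => k; rewrite mxE.
have c'1 : (fun k => c' k 0 1) = (fun k => set_val c k 0 1).
  by apply/funext => k; rewrite mxE.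
have c'P : c' \in @arc_germs R 2.
  apply/mem_set; split.
    by apply/rowP => i; rewrite !mxE; have [->|->] := ord2P i; rewrite /= ?d0// c0 mxE.
  move=> i; have [->|->] := ord2P i; last by rewrite c'1.
  by rewrite c'0; exact: abs_bound_convergent dM.
exists (exist _ c' c'P); apply: cvg_within => /=.
apply: filterS2 wE (near_le_norm r0) => t wt tr; apply/rowP => i.
rewrite !mxE; have [->|->] := ord2P i => /=; last by rewrite c'1.
transitivity (psum d t); first by rewrite -wd// add0r wt.
by rewrite /psum -c'0.
Qed.

Lemma abs_le_linear (x C : R) : (\forall t \near (0 : R)^'+, `|x| <= t * C) -> x = 0.
Proof.
move=> h; apply/eqP; rewrite -normr_le0 leNgt; apply/negP => x0.
have [s s0 sC] := exists_small_mul x0 (normr_ge0 C).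
near (0 : R)^'+ => t.
have : `|x| <= t * C by near: t.
have t0 : 0 < t by near: t; exact: nbhs_right_gt.
have ts : t < s by near: t; exact: nbhs_right_lt.
apply/negP; rewrite -ltNge; apply: le_lt_trans sC.
apply: (@le_trans _ _ (t * `|C|)); first by rewrite ler_wpM2l ?ler_norm// ltW.
by rewrite ler_wpM2r// ltW.
Unshelve. all: by end_near.
Qed.

(** Uniqueness of the Taylor coefficients: with the tail from index [3] on bounded by [N], dividing
    by [t] and letting [t] tend to [0] gives [d_1 = A]; dividing once more gives [d_2 = B]. *)
Lemma coef2_unique (d : R^nat) (A B C : R) : convergent_series d -> d 0%N = 0 ->
  (\forall t \near (0 : R)^'+, `|psum d t - (A * t + B * t ^+ 2)| <= C * t ^+ 3) ->
  d 2%N = B.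
Proof.
move=> /convergent_abs_bound[r [M [r0 dM]]] d0 h.
have d1M := abs_bound_shift r0 dM; have d2M := abs_bound_shift r0 d1M.
have d3M := abs_bound_shift r0 d2M.
set N := M / r / r / r in d3M; have N0 := abs_bound_ge0 d3M.
have h2 : \forall t \near (0 : R)^'+, [/\ 0 < t, t <= 1 &
    `|(d 1%N - A) + (d 2%N - B) * t| <= (`|C| + N) * t ^+ 2].
  near=> t; have t0 : 0 < t by near: t; exact: nbhs_right_gt.
  have t1 : t <= 1 by near: t; exact: nbhs_right_le.
  have tr : `|t| <= r by rewrite gtr0_norm//; near: t; exact: nbhs_right_le.
  split => //.
  have : `|psum d t - (A * t + B * t ^+ 2)| <= C * t ^+ 3 by near: t.
  rewrite (psum_recl r0 dM tr) (psum_recl r0 d1M tr) (psum_recl r0 d2M tr) d0.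
  have := psum_bound d3M tr; set D := psum _ t => DN hC.
  rewrite -(ler_pM2l t0) -{1}(gtr0_norm t0) -normrM.
  have -> : t * (d 1%N - A + (d 2%N - B) * t) =
    0 + t * (d 1%N + t * (d 2%N + t * D)) - (A * t + B * t ^+ 2) - t ^+ 3 * D by ring.
  apply: le_trans (ler_normB _ _) _.
  have -> : t * ((`|C| + N) * t ^+ 2) = `|C| * t ^+ 3 + t ^+ 3 * N by ring.
  have t3 : 0 <= t ^+ 3 by rewrite exprn_ge0// ltW.
  apply: lerD; last by rewrite normrM (ger0_norm t3) ler_wpM2l.
  by apply: le_trans hC _; rewrite ler_wpM2r// ler_norm.
have A0 : d 1%N - A = 0.
  apply: (@abs_le_linear _ (`|C| + N + `|d 2%N - B|)); apply: filterS h2 => t [t0 t1 ht].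
  have -> : d 1%N - A = d 1%N - A + (d 2%N - B) * t - (d 2%N - B) * t by ring.
  apply: le_trans (ler_normB _ _) _; rewrite mulrDr [t * (_ + _)]mulrC.
  apply: lerD; last by rewrite normrM (gtr0_norm t0) mulrC.
  apply: le_trans ht _; rewrite ler_wpM2l ?addr_ge0//.
  by rewrite expr2 ger_pMl.
apply/eqP; rewrite -subr_eq0; apply/eqP/(@abs_le_linear _ (`|C| + N)).
apply: filterS h2 => t [t0 t1]; rewrite A0 add0r normrM (gtr0_norm t0) expr2 mulrA.
by rewrite ler_pM2r// mulrC.
Unshelve. all: by end_near.
Qed.

Lemma parabola_evalE (e t : R) : arc_eval (parabola_arc e) t = point2 (e * t) (t ^+ 2).
Proof.
have z0 : abs_bound (fun=> 0 : R) (`|t| + 1) 0 by exact: abs_bound0.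
have r0 : 0 < `|t| + 1 by rewrite ltr_wpDl.
have tr : `|t| <= `|t| + 1 by rewrite lerDl.
have h c := psum_scons c r0 z0 tr.
apply/rowP => i; rewrite !mxE -/(psum _ t).
case: (ord2P i) => ->.
  rewrite (_ : (fun k => _) = scons 0 (scons e (fun=> 0))); last first.
    by apply/funext => -[|[|[|k]]]; rewrite /= /parabola_coef /= !mxE.
  by rewrite (psum_scons _ r0 (abs_bound_scons e r0 z0) tr) h psum0 mulr0 addr0 add0r /= mulrC.
have z1 := abs_bound_scons 1 r0 z0.
rewrite (_ : (fun k => _) = scons 0 (scons 0 (scons 1 (fun=> 0)))); last first.
  by apply/funext => -[|[|[|k]]]; rewrite /= /parabola_coef /= !mxE.
rewrite (psum_scons _ r0 (abs_bound_scons 0 r0 z1) tr) (psum_scons _ r0 z1 tr) h.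
by rewrite psum0 mulr0 addr0 !add0r mulr1 /= expr2.
Qed.

(* For [e > 0] one has [shear 1 (e t, t^2) = (e t kappa 1 (t / e), t^2)]
   with first coordinate [e t + 2 t^2 + O(t^4)], for [e = 0] it vanishes. *)
Lemma shear_parabola_coef2 (e : R) (c : set_type (@arc_germs R 2)) : 0 <= e ->
  (\forall t \near (0 : R)^'+, shear 1 (arc_eval (parabola_arc e) t) = arc_eval c t) ->
  set_val c 2%N 0 0 = if e == 0 then 0 else 2.
Proof.
move=> e0 h; have [] := set_valP c; rewrite -set_valE => c0 cc.
(* For [0 < t <= e] the error is at most [e t * 2 (t / e)^3 = 2 t^4 / e^2], hence at most
   [2 t^3 / e^2] if [t <= 1]. For [e = 0] the constant is [0], as the inverse of [0] is [0], and so
   is the error. *)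
apply: (@coef2_unique (fun k => set_val c k 0 0) e _ (2 / e ^+ 2)) (cc 0) _ _.
  by rewrite c0 mxE.
have te : \forall t \near (0 : R)^'+, e = 0 \/ 0 < e /\ t <= e.
  move: e0; rewrite le_eqVlt => /orP[/eqP <-|e0]; first by apply: nearW; left.
  by near=> t; right; split => //; near: t; exact: nbhs_right_le.
near=> t; have t0 : 0 < t by near: t; exact: nbhs_right_gt.
have t1 : t <= 1 by near: t; exact: nbhs_right_le.
have : shear 1 (arc_eval (parabola_arc e) t) = arc_eval c t by near: t.
rewrite parabola_evalE /shear => /rowP/(_ 0); rewrite !mxE /= -/(psum _ t) => <-.
have [->|[e1 te1]] : e = 0 \/ 0 < e /\ t <= e by near: t.
  by rewrite eqxx /shearx !mul0r addr0 subrr normr0 expr0n /= invr0 mulr0 mul0r.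
have en : e != 0 by rewrite gt_eqF.
rewrite (negbTE en).
have s0 : 0 <= t / e by rewrite divr_ge0 ?ltW.
have s1 : t / e <= 1 by rewrite ler_pdivrMr ?mul1r.
have := kappa1_expansion s0 s1.
have -> : t / e = t ^+ 2 / (e * t) by field; rewrite en gt_eqF.
rewrite /shearx; set k := kappa _ _ => hk.
have -> : e * t * k - (e * t + 2 * t ^+ 2) = e * t * (k - 1 - 2 * (t ^+ 2 / (e * t))).
  by field; rewrite en gt_eqF.
rewrite normrM (gtr0_norm (mulr_gt0 e1 t0)).
have et0 : 0 <= e * t by rewrite mulr_ge0 ?ltW.
apply: le_trans (ler_wpM2l et0 hk) _.
have -> : e * t * (2 * (t ^+ 2 / (e * t)) ^+ 3) = 2 / e ^+ 2 * t ^+ 3 * t.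
  by field; rewrite en gt_eqF.
by rewrite ger_pMr// mulr_gt0 ?divr_gt0 ?exprn_gt0.
Unshelve. all: by end_near.
Qed.
End Arcs.

(** * The shear of the plane and its discontinuity on arcs *)

Section ShearMap.
Context {R : realType}.

Lemma cvg_ptws T (V : topologicalType) (F : set_system T) (FF : Filter F)
    (f : T -> prod_topology (fun _ : nat => V)) (l : prod_topology (fun _ : nat => V)) :
  (forall k, f x k @[x --> F] --> l k) -> f @ F --> l.
Proof.
move=> h; apply/cvg_sup => k U [? /= [[W oW <-]]] /= Wl /filterS; apply.
by apply: (h k); exact: open_nbhs_nbhs.
Qed.

Lemma arc_coef_continuous k i :
  continuous (fun c : set_type (@arc_germs R 2) => set_val c k 0 i).
Proof.
move=> c; have h : continuous (fun c : set_type (@arc_germs R 2) => set_val c).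
  exact: initial_continuous.
have h1 := cvg_comp _ _ (h c) (@proj_continuous nat (fun=> 'rV[R]_2) k (set_val c)).
exact: (cvg_comp _ _ h1 (@coord_continuous _ _ _ _ _ _)).
Qed.

Lemma point2_0 (x y : R) : point2 x y 0 0 = x. Proof. by rewrite mxE. Qed.
Lemma point2_1 (x y : R) : point2 x y 0 1 = y. Proof. by rewrite mxE. Qed.

Lemma point2P (v w : 'rV[R]_2) : v 0 0 = w 0 0 -> v 0 1 = w 0 1 -> v = w.
Proof.
move=> v0 v1; apply/rowP => -[[|[|//]] ?].
  by rewrite (_ : Ordinal _ = 0)//; apply/val_inj.
by rewrite (_ : Ordinal _ = 1)//; apply/val_inj.
Qed.

Lemma shear_conic (b : R) (k : R) v : shear b (k *: v) = k *: shear b v.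
Proof.
apply: point2P; rewrite mxE ?point2_0 ?point2_1 !mxE//.
exact: shearxZ.
Qed.

Lemma shearK (b : R) : cancel (shear b) (shear (- b)).
Proof.
move=> v; apply: point2P; rewrite ?point2_0 ?point2_1//.
exact: shearxK.
Qed.

(** Along [(1, s)] the first coordinate is [kappa b s], along [(s, 1)] it is [s / kappa (- b) s]. *)
Lemma shear_analytic (b : R) i j (s : R) : analytic1 (fun s => shear b (dirv i s) 0 j) s.
Proof.
have [->|->] := ord2P j; under eq_fun do rewrite ?point2_0 ?point2_1.
2: exact: dirv_analytic.
have [->|->] := ord2P i; under eq_fun do rewrite !mxE /=.
  under eq_fun do rewrite /shearx mul1r divr1.
  by apply: analytic1_kappa; exact: analytic1_id.
under eq_fun do rewrite shearx_inv ?oner_eq0// divr1.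
apply: analytic1M; first exact: analytic1_id.
apply: analytic1V; first by rewrite gt_eqF// kappa_gt0.
by apply: analytic1_kappa; exact: analytic1_id.
Qed.

Lemma shear_cvg0 (b : R) : shear b x @[x --> (0 : 'rV[R]_2)] --> (0 : 'rV[R]_2).
Proof.
have c i : x 0 i @[x --> (0 : 'rV[R]_2)] --> (0 : R).
  by have := @coord_continuous R 1 2 0 i 0; rewrite /continuous_at mxE.
have nc i : `|x 0 i| @[x --> (0 : 'rV[R]_2)] --> (0 : R).
  by rewrite -(normr0 R); apply: cvg_norm; exact: c.
apply: (@cvg_mx _ _ _ _ (nbhs (0 : 'rV[R]_2)) _) => i j; rewrite ord1 mxE.
case: (ord2P j) => ->; under eq_fun do rewrite ?point2_0 ?point2_1; last exact: c.
apply: norm_cvg0; apply: (@squeeze_cvgr _ _ _ _ (fun=> 0)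
  (fun x : 'rV[R]_2 => `|x 0 0| + (2 * `|b| + 1) * `|x 0 1|)).
- by apply: nearW => x; rewrite normr_ge0 norm_shearx_le.
- exact: cvg_cst.
- rewrite -[X in _ --> X](_ : 0 + (2 * `|b| + 1) * 0 = _); last by rewrite mulr0 addr0.
  by apply: cvgD; [exact: nc|apply: cvgMr; exact: nc].
Qed.

Lemma parabola_arc_cvg : parabola_arc e @[e --> (0 : R)^'] --> parabola_arc (0 : R).
Proof.
apply: (@cvg_set_val _ _ _ ((0 : R)^') _) => /=.
apply: (@cvg_ptws _ _ ((0 : R)^') _ (fun e => parabola_coef e)) => k.
apply: (@cvg_mx _ _ _ _ ((0 : R)^') _) => i j; rewrite ord1.
have c0 (l : R) : l @[_ --> (0 : R)^'] --> l by exact: cvg_cst.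
case: k => [|[|[|k]]]; rewrite /parabola_coef /=; try exact: c0.
rewrite mxE; under eq_fun do rewrite mxE.
case: j => [[|[|//]] ?] /=; last exact: c0.
apply: (@cvg_within_filter _ _ id); exact: cvg_id.
Qed.

(** The coefficient of [t^2] in the first coordinate is a continuous function of the arc, but on the
    images it is [2] for [e > 0] and [0] for [e = 0]. *)
Lemma shear_arcs_discontinuous (phi_star : set_type (@arc_germs R 2) -> set_type (@arc_germs R 2)) :
  induces_on_arcs (shear 1) phi_star ->
  ~ (phi_star (parabola_arc e) @[e --> (0 : R)^'] --> phi_star (parabola_arc (0 : R))).
Proof.
move=> h /cvg_comp/(_ (@arc_coef_continuous 2 0 _)).
rewrite (shear_parabola_coef2 (lexx 0) (h (parabola_arc 0))) eqxx => /cvgrPdist_lt/(_ 1 ltr01) c.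
have : \forall e \near (0 : R)^', 0 < e -> False.
  apply: filterS c => e /= + e0; rewrite (shear_parabola_coef2 (ltW e0) (h (parabola_arc e))).
  by rewrite gt_eqF// sub0r normrN ger0_norm//; lra.
rewrite near_withinE => /nbhs_ballP[r /= r0 rP].
(* A positive parameter inside the punctured ball contradicts the limit. *)
apply: (rP (r / 2)) _ (divr_gt0 r0 _) => //=; last by rewrite gt_eqF// divr_gt0.
rewrite -ball_normE /= sub0r normrN gtr0_norm ?divr_gt0//.
by rewrite ltr_pdivrMr// mulr_natr mulr2n ltrDl.
Qed.

Lemma nonzero_germ_coord i : nonzero_germ (fun v : 'rV[R]_2 => v 0 i).
Proof.
move=> /nbhs_ballP[r /= r0 rP].
have : (const_mx (r / 2) : 'rV[R]_2) 0 i = 0.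
  apply: rP; split => // k j; rewrite !mxE -ball_normE /= sub0r normrN.
  by rewrite gtr0_norm ?divr_gt0// ltr_pdivrMr// mulr_natr mulr2n ltrDl.
by rewrite mxE => /eqP; rewrite gt_eqF// divr_gt0.
Qed.
End ShearMap.

Theorem mainTheorem2 (R : realType) :
  let M := @std_blowup R 2 predT in
  let pi : M -> euclidean 2 := @std_blowdown R 2 predT in
  let f : 'rV[R]_2 -> R := fun p => p 0 (lift ord0 ord0) in
  parabola_arc e @[e --> (0 : R)^'] --> parabola_arc (0 : R) /\
  (exists (Phi : M -> M) (phi : 'rV[R]_2 -> 'rV[R]_2)
          (phi_star : set_type (@arc_germs R 2) -> set_type (@arc_germs R 2)),
    analytic_diffeo Phi /\
    (blow_analytic_homeo setT setT phi /\ phi 0 = 0 /\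
     forall z, phi (pi z) = pi (Phi z)) /\
    (forall p, f (phi p) = f p) /\
    (induces_on_arcs phi phi_star /\
     ~ (phi_star (parabola_arc e) @[e --> (0 : R)^'] -->
        phi_star (parabola_arc (0 : R))))) /\
  (exists (U V : set 'rV[R]_2) (phi : 'rV[R]_2 -> 'rV[R]_2)
          (g h : 'rV[R]_2 -> R)
          (phi_star : set_type (@arc_germs R 2) -> set_type (@arc_germs R 2)),
    analytic_fun_germ g /\ analytic_fun_germ h /\
    nonzero_germ g /\ nonzero_germ h /\
    realises_blow_analytic_equivalence U V phi g h /\
    induces_on_arcs phi phi_star /\
    ~ continuous phi_star).
Proof.
move=> M pi f.
have [D B] := conic_blow_analytic (@shear_conic R 1) (shear_conic (-1)) (shear_analytic 1)
  (shear_analytic (-1)) (shear_cvg0 1) (shear_cvg0 (-1)) (shearK 1)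
  (* The second cancellation is [shearK (-1)] with [- - 1] replaced by [1]. *)
  (fun v => etrans (congr1 (fun b => shear b (shear (-1) v)) (esym (opprK 1))) (shearK (-1) v)).
have [phi_star phiP] := choice (@shear_arc R 1).
have sneq0 := conic_neq0 (@shear_conic R 1) (shearK 1).
have s0 : shear (R := R) 1 0 = 0 by exact: conic0 (shear_conic 1).
have fshear v : f (shear 1 v) = f v.
  by rewrite /f /shear mxE /=; congr (v 0 _); exact/val_inj.
have fgerm : analytic_fun_germ f by split; [exact: analytic_coord|rewrite /f mxE].
split; first exact: parabola_arc_cvg.
split.
  exists (blift (shear 1)), (shear 1), phi_star; do ![split => //].
    by move=> z; rewrite /pi /std_blowdown (blift_point (shear_conic 1) sneq0).
  exact: shear_arcs_discontinuous.
(* Since [f] is invariant under the shear, it serves as both germs. *)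
exists setT, setT, (shear 1), f, f, phi_star; do ![split => //].
- exact: nonzero_germ_coord.
- exact: nonzero_germ_coord.
- by apply: (@nearW _ (nbhs (0 : 'rV[R]_2)) _ (nbhs_filter _)) => x; rewrite fshear.
(* Continuity would transport the convergence of the parabolas to their images. *)
- move=> cont; apply: (shear_arcs_discontinuous phiP).
  exact: (cvg_comp _ _ parabola_arc_cvg (cont _)).
Qed.
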